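(* Let $G$ be a group, let $T$ be a $G$-tree, and let $U$ be a $G$-retract of the $G$-set $VT$. Suppose that the $G$-set $ET$ has $G$-conjugate-incomparable stabilizers, or, more generally, that the $G$-set $VT-U$ has $G$-conjugate-incomparable stabilizers. Then applying to $T$ some transfinite sequence of $G$-equivariant sliding operations followed by some $G$-equivariant compressing operation yields a $G$-tree $T'$ such that $VT'=U$. Here $ET'$ is a $G$-subset of $ET$, and there exists a $G$-set isomorphism $ET-ET'\simeq VT-VT'=VT-U$.
   Context: All $G$-actions are left actions; $G_x$ denotes the stabilizer of $x$; for $H\le G$ and $g\in G$, $H^g=g^{-1}Hg$. A $G$-graph $(T,V,E,\iota,\tau)$ consists of a nonempty $G$-set $V$ (vertices), a $G$-set $E$ (edges) and $G$-maps $\iota,\tau\colon E\to V$ (initial and terminal vertex). A $G$-tree is a $G$-graph whose underlying graph (forgetting orientation) is a tree; $VT$ and $ET$ are its vertex and edge sets. A $G$-retract $U$ of a $G$-set $V$ is a $G$-subset of $V$ such that, for each $w\in V-U$, there exists $u\in U$ with $G_w\le G_u$; equivalently, there is a $G$-map $V\to U$ which is the identity on $U$. A subgroup $H$ of $G$ is $G$-conjugate incomparable if, for each $g\in G$, $H^g\subseteq H$ only if $H^g=H$. A $G$-set $X$ has $G$-conjugate-incomparable stabilizers if $G_x$ is a $G$-conjugate-incomparable subgroup for each $x\in X$. To $G$-equivariantly reorient a $G$-tree means to interchange the values of $\iota$ and $\tau$ on some $G$-subset of $E$. Sliding: let $e,f\in E$ with $\tau e=\iota f$, $G_e\le G_f$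 and $Gf\cap Ge=\emptyset$. $G$-equivariantly sliding $\tau e$ along $f$ from $\iota f$ to $\tau f$ replaces $\tau$ by the map $\tau'\colon E\to V$ with $\tau'(ge)=\tau(gf)$ for $g\in G$ and $\tau'(e')=\tau(e')$ for $e'\in E-Ge$; the result $(T',V,E,\iota,\tau')$ is again a $G$-tree. A $G$-equivariant sliding operation consists of first $G$-equivariantly reorienting $Ge$, or $Gf$, or both, or neither, then performing such a slide of $\tau e$ along $f$, then reorienting back again. A transfinite sequence of $G$-equivariant sliding operations applied to $T$ is a family of $G$-trees $(T_\beta=(T_\beta,V,E,\iota_\beta,\tau_\beta))_{\beta\le\lambda}$, indexed by the ordinals $\beta\le\lambda$ for some ordinal $\lambda$, with the same $G$-sets $V$ and $E$, such that $T_0=T$, each $T_{\beta+1}$ is obtained from $T_\beta$ by one $G$-equivariant sliding operation, and, for each limit ordinal $\beta\le\lambda$ and each $e\in E$, the values $\iota_\alpha(e)$ and $\tau_\alpha(e)$ are eventually constant as $\alpha$ increases to $\beta$ and $\iota_\beta(e),\tau_\beta(e)$ are these eventual values. The result is $T_\lambda$. Compressing: a vertex $v$ of a tree is a sink if every edge of the tree is oriented towards $v$. Let $E'$ be a $G$-subset of $E$ such that each component of the subforest $T-E'$ (vertex set $V$, edge set $E-E'$) has a (necessarily unique) sink; let $V'$ be the set of these sinks and $\phi\colon V\to V'$ the map sending $v$ to the sink of the component of $T-E'$ containing $v$. Compressing the components of $T-E'$ to their sinks yields the $G$-tree with vertex set $V'$, edge set $E'$, and initial and terminal vertex maps $\phi\circ\iota|_{E'}$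 and $\phi\circ\tau|_{E'}$. A $G$-equivariant compressing operation consists of first $G$-equivariantly reorienting $T$ and then performing such a compression. *)

(* Defs.v *)
From Stdlib Require List.
From mathcomp Require Import all_boot.
From mathcomp Require Import boolp classical_sets.
From mathcomp Require wochoice.

Set Implicit Arguments.
Unset Strict Implicit.
Unset Printing Implicit Defensive.

Local Open Scope classical_set_scope.
Local Open Scope group_scope.

(* Groups are MathComp's [groupType]: not assumed finite. *)

Record gset (G : groupType) := GSet {
  carrier :> Type;
  act : G -> carrier -> carrier;
  act1 : forall x, act 1 x = x;
  actM : forall g h x, act (g * h) x = act g (act h x)
}.

Definition equivariant (G : groupType) (X Y : gset G) (f : X -> Y) : Prop :=
  forall g x, f (act g x) = act g (f x).

Definition gset_iso (G : groupType) (X Y : gset G) : Prop :=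
  exists f : X -> Y, equivariant f /\ bijective f.

Definition stab (G : groupType) (X : gset G) (x : X) : set G :=
  [set g | act g x = x].

Definition orbit (G : groupType) (X : gset G) (x : X) : set X :=
  [set act g x | g in [set: G]].

Record gsubset (G : groupType) (X : gset G) := GSubset {
  gsubset_set :> set X;
  gsubset_act : forall g x, gsubset_set x -> gsubset_set (act g x)
}.

Section SubGSet.
Variables (G : groupType) (X : gset G) (A : gsubset X).

Definition sub_act (g : G) (x : A) : A :=
  exist _ (act g (val x)) (mem_set (gsubset_act g (set_mem (valP x)))).

Lemma sub_act1 x : sub_act 1 x = x.
Proof. by apply: val_inj; rewrite /= act1. Qed.

Lemma sub_actM g h x : sub_act (g * h) x = sub_act g (sub_act h x).
Proof. by apply: val_inj; rewrite /= actM. Qed.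

Definition sub_gset : gset G := GSet sub_act1 sub_actM.

Lemma gsubsetC_act g x : (~` A) x -> (~` A) (act g x).
Proof.
by move=> nAx Agx; apply: nAx; rewrite -(act1 x) -(mulVg g) actM; apply: gsubset_act.
Qed.

Definition gsubsetC : gsubset X := GSubset gsubsetC_act.

End SubGSet.

Definition gretract (G : groupType) (V : gset G) (U : gsubset V) : Prop :=
  forall w : V, (~` U) w -> exists2 u : V, (U : set V) u & stab w `<=` stab u.

(* [h ^ g] is [g^-1 * (h * g)]. *)
Definition conj_set (G : groupType) (H : set G) (g : G) : set G :=
  [set h ^ g | h in H].

Definition conj_incomparable (G : groupType) (H : set G) : Prop :=
  forall g : G, conj_set H g `<=` H -> conj_set H g = H.

Definition conj_incomparable_stabilizers (G : groupType) (X : gset G) : Prop :=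
  forall x : X, conj_incomparable (stab x).

Record ggraph (G : groupType) (V E : gset G) := GGraph {
  ini : E -> V;
  ter : E -> V;
  ini_equivariant : equivariant ini;
  ter_equivariant : equivariant ter
}.

Section Graphs.
Variables (G : groupType) (V E : gset G).
Implicit Types (T : ggraph V E) (F : set E) (v w : V) (e f : E).

(* A dart [(e, b)] is the edge [e] traversed from [ini e] to [ter e] if
   [b = true], and from [ter e] to [ini e] if [b = false]. *)
Definition source T (d : E * bool) : V := if d.2 then ini T d.1 else ter T d.1.
Definition target T (d : E * bool) : V := if d.2 then ter T d.1 else ini T d.1.

Fixpoint walk T v (p : seq (E * bool)) w : Prop :=
  if p is d :: p' then source T d = v /\ walk T (target T d) p' w else v = w.

(* [joined T F v w]: [v] and [w] lie in the same component of the subgraph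
   with vertex set [V] and edge set [F]. *)
Definition joined T F v w : Prop :=
  exists2 p, walk T v p w & forall d, List.In d p -> F d.1.

(* Distinct edges are required so that going back and forth along a single
   edge does not count; a loop and a pair of parallel edges do. *)
Definition circuit T (p : seq (E * bool)) : Prop :=
  [/\ p <> [::], exists v, walk T v p v,
      List.NoDup (map (source T) p) & List.NoDup (map fst p)].

Definition is_tree T : Prop :=
  [/\ exists v : V, True, forall v w, joined T [set: E] v w
    & forall p, ~ circuit T p].

Definition reorients (D : set E) T T' : Prop :=
  forall e, (D e -> ini T' e = ter T e /\ ter T' e = ini T e) /\
            (~ D e -> ini T' e = ini T e /\ ter T' e = ter T e).

Definition slides e f T T' : Prop :=
  [/\ ter T e = ini T f, stab e `<=` stab f & orbit f `&` orbit e = set0] /\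
  [/\ forall e', ini T' e' = ini T e',
      forall g, ter T' (act g e) = ter T (act g f)
    & forall e', ~ orbit e e' -> ter T' e' = ter T e'].

Definition sliding_operation T T' : Prop :=
  exists e f (D : set E) (T1 T2 : ggraph V E),
    [\/ D = set0, D = orbit e, D = orbit f | D = orbit e `|` orbit f] /\
    [/\ reorients D T T1, slides e f T1 T2 & reorients D T2 T'].

(* For [F] the edge set of a subforest of a tree, an edge [e] of the component
   of [v] is oriented towards [v] when [v] is on the side of [ter e], that is,
   when [ter e] and [v] are still joined after [e] is removed. *)
Definition sink T F v : Prop :=
  forall e, F e -> joined T F (ini T e) v -> joined T (F `\ e) (ter T e) v.

Definition sink_of T F v s : Prop := joined T F v s /\ sink T F s.

End Graphs.

Record gtree (G : groupType) (V E : gset G) := GTree {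
  gtree_graph :> ggraph V E;
  gtree_is_tree : is_tree gtree_graph
}.

(* The ordinals [beta <= lambda] are represented by a well-ordered type [I]
   with least element [o] (the ordinal 0) and greatest element [l] (lambda). *)
Section WellOrder.
Variables (I : Type) (le : rel I).

Definition wo_lt (a b : I) : Prop := le a b /\ a <> b.

Definition wo_succ (a b : I) : Prop :=
  wo_lt a b /\ forall c, ~ (wo_lt a c /\ wo_lt c b).

Definition wo_limit (b : I) : Prop :=
  (exists a, wo_lt a b) /\ forall a, ~ wo_succ a b.

End WellOrder.

Definition sliding_sequence (G : groupType) (V E : gset G) (T T' : gtree V E) :
    Prop :=
  exists (I : Type) (le : rel I) (o l : I) (S : I -> gtree V E),
    [/\ wochoice.well_order le, forall a, le o a & forall a, le a l] /\
    [/\ S o = T,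
        forall a b, wo_succ le a b -> sliding_operation (S a) (S b),
        forall b, wo_limit le b -> forall e : E,
          exists2 c, wo_lt le c b &
            forall a, le c a -> wo_lt le a b ->
              ini (S a) e = ini (S b) e /\ ter (S a) e = ter (S b) e
      & S l = T'].

(* Compressing the components of [T - E'] to their sinks, which must form [V'],
   yields [T']. *)
Definition compresses (G : groupType) (V E : gset G) (T : ggraph V E)
    (V' : gsubset V) (E' : gsubset E)
    (T' : ggraph (sub_gset V') (sub_gset E')) : Prop :=
  [/\ forall v, exists s, sink_of T (~` E') v s,
      V' = [set s | sink T (~` E') s] :> set V
    & forall e : sub_gset E',
        sink_of T (~` E') (ini T (val e)) (val (ini T' e)) /\
        sink_of T (~` E') (ter T (val e)) (val (ter T' e))].

Definition compressing_operation (G : groupType) (V E : gset G)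
    (T : ggraph V E) (V' : gsubset V) (E' : gsubset E)
    (T' : ggraph (sub_gset V') (sub_gset E')) : Prop :=
  exists (D : gsubset E) (T1 : ggraph V E),
    reorients D T T1 /\ compresses T1 T'.

(* Main.v *)
Require Import Defs.
From mathcomp Require Import all_boot.
From mathcomp Require Import boolp classical_sets.
Import Defs.

Set Implicit Arguments.
Unset Strict Implicit.
Unset Printing Implicit Defensive.

Local Open Scope classical_set_scope.
Local Open Scope group_scope.

(** A vertex [w] outside [U] satisfies [stab w `<=` stab u] for some [u] in
    [U].  Hence [stab w] fixes the geodesic from [w] to [u], whose first edge
    therefore has the stabilizer of [w].  If that edge leads to another orbit,
    compressing its orbit removes the orbit of [w] together with an isomorphic
    orbit of edges, and [U] is still a retract.  Iterating this may however
    push [w] away for ever without reaching [U]; sliding is the remedy.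

    Absorption.  Compressions are only planned: a state records the set
    [merged] of the edges to be compressed, and the vertex [rep v] into which
    [v] is thereby merged.  In the compressed tree, consider a shortest path
    [w, y, z, ..., u] with [u] in [U] that is fixed by [stab w].  Conjugate
    incomparability prevents it from coming back to the orbit of [w]
    ([rpath_apath]).  Let [e] be its first edge and [f] its second one.  If [f]
    can itself be compressed, then it is merged; otherwise [e] is slid along
    [f], and then joins [w] to [z].  In both cases the path gets shorter, until
    [e] joins [w] to a vertex of [U] and is merged as well ([absorb]).

    Convergence.  An edge along which another one is slid is either merged, or
    rigid: it can neither be merged now nor at any later time.  Such edges are
    frozen, they never move again, so that each edge moves during at most one
    absorption, finitely often.  The limit of a chain of states is again a tree.
    An edge that was not a bridge in the limit would already fail to be one at
    some earlier stage, and the limit is connected because the ends in the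
    initial tree of any edge stay linked by this edge together with frozen
    ones ([good_origin], [limit_is_tree]).

    Completeness.  While [w] is absorbed, finitely many other orbits may get
    merged into vertices outside [U].  Absorbing these next, and so on
    countably often, one reaches a state in which every vertex that has been
    merged at all is merged into [U] ([settle_all]); this is what makes [rep]
    converge along chains of such states ([chain_limit]).  Zorn's lemma then
    yields a state in which all vertices are merged into [U]
    ([fully_absorbed]).

    Compression.  In that state the merged edges form a forest each component
    of which contains exactly one vertex of [U].  Oriented towards these
    vertices, the forest can be compressed to [U], and mapping an edge to its
    initial vertex is an isomorphism from the edges that disappear to the
    vertices that disappear ([compressed_compressing], [compressed_iso]). *)

(** * Group actions and stabilizers *)

Section GSets.
Variables (G : groupType) (X : gset G).
Implicit Types (x y : X) (g h : G).

Lemma actK g x : act g^-1 (act g x) = x.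
Proof. by rewrite -actM mulVg act1. Qed.

Lemma actVK g x : act g (act g^-1 x) = x.
Proof. by rewrite -actM mulgV act1. Qed.

Lemma act_inj g x y : act g x = act g y -> x = y.
Proof. by move=> e; rewrite -(actK g x) e actK. Qed.

Lemma orbit_act x g : orbit x (act g x).
Proof. by exists g. Qed.

Lemma orbit_refl x : orbit x x.
Proof. by exists 1 => //; rewrite act1. Qed.

Lemma orbit_sym x y : orbit x y -> orbit y x.
Proof. by case=> g _ <-; exists g^-1 => //; rewrite actK. Qed.

Lemma orbit_trans x y z : orbit x y -> orbit y z -> orbit x z.
Proof. by case=> g _ <- [h _ <-]; exists (h * g) => //; rewrite actM. Qed.

Lemma orbit_actE x y g : orbit x (act g y) <-> orbit x y.
Proof.
split=> xy; last exact: orbit_trans xy (orbit_act y g).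
exact: orbit_trans xy (orbit_sym (orbit_act y g)).
Qed.

Lemma gsubset_actE (A : gsubset X) g x :
  (A : set X) (act g x) <-> (A : set X) x.
Proof.
by split=> [/(gsubset_act g^-1)|/(gsubset_act g)//]; rewrite actK.
Qed.

Lemma stab_eq g h x : stab x (h^-1 * g) -> act g x = act h x.
Proof. by move=> s; rewrite -[g](mulVKg h) actM s. Qed.

Lemma eq_stab g h x : act g x = act h x -> stab x (h^-1 * g).
Proof. by move=> e; rewrite /stab /= actM e actK. Qed.

Lemma stab_act g h x : stab (act g x) h <-> stab x (g^-1 * (h * g)).
Proof.
rewrite /stab /= !actM; split=> [->|e]; first by rewrite actK.
by rewrite -[in RHS]e actVK.
Qed.

End GSets.

Lemma stab_actS (G : groupType) (X Y : gset G) (x : X) (y : Y) g :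
  stab x `<=` stab y -> stab (act g x) `<=` stab (act g y).
Proof. by move=> s h /stab_act /s /stab_act. Qed.

Lemma stab_map (G : groupType) (X Y : gset G) (f : X -> Y) x :
  equivariant f -> stab x `<=` stab (f x).
Proof. by move=> ef g; rewrite /stab /= -ef => ->. Qed.

(** The stabilizer of [act g x] is [g * stab x * g^-1], so the inclusion says
    that conjugation by [g] maps [stab x] into itself. *)
Lemma incomparable_stab_act (G : groupType) (X : gset G) (x : X) g :
  conj_incomparable (stab x) -> stab x `<=` stab (act g x) ->
  stab (act g x) = stab x.
Proof.
move=> ci le; have sub : conj_set (stab x) g `<=` stab x.
  by move=> _ [h hx <-]; move/le/stab_act: hx.
have /seteqP [_ ge] := ci g sub.
apply/seteqP; split=> // h /stab_act /ge [k kx].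
by rewrite /conjg => /mulgI /mulIg <-.
Qed.

(** * Linked vertices and trees *)

Section Linked.
Variables (G : groupType) (V E : gset G).
Implicit Types (T : ggraph V E) (F : set E) (P : set V) (v w x y z : V).
Implicit Types (e f h : E).

(** Paths are replaced by the vertex sets that no edge of [F] splits, since
    these are easily transported from one tree to another: a graph is connected
    when no such set is proper, and an edge is a bridge when some such set for
    the other edges separates its ends. *)
Definition unsplit T F P : Prop :=
  forall e, F e -> (P (ini T e) <-> P (ter T e)).

Definition linked T F v w : Prop := forall P, unsplit T F P -> P v -> P w.

Definition ends T e x y : Prop :=
  (ini T e = x /\ ter T e = y) \/ (ini T e = y /\ ter T e = x).

Lemma endsC T e x y : ends T e x y -> ends T e y x.
Proof. by case; [right|left]. Qed.

Lemma ends_ini T e : ends T e (ini T e) (ter T e).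
Proof. by left. Qed.

Lemma ends_act T e x y g :
  ends T e x y -> ends T (act g e) (act g x) (act g y).
Proof.
by rewrite /ends ini_equivariant ter_equivariant; case=> [[-> ->]|[-> ->]];
  [left|right].
Qed.

Lemma stab_end T e x y : ends T e x y -> stab e `<=` stab x.
Proof.
case=> [[<- _]|[_ <-]]; apply: stab_map.
  exact: ini_equivariant.
exact: ter_equivariant.
Qed.

Lemma unsplit_ends T F P e x y :
  unsplit T F P -> F e -> ends T e x y -> P x <-> P y.
Proof. by move=> c /c ce [[<- <-]|[<- <-]] //; rewrite ce. Qed.

Lemma linked_refl T F v : linked T F v v.
Proof. by move=> P. Qed.

Lemma linked_trans T F v w x :
  linked T F v w -> linked T F w x -> linked T F v x.
Proof. by move=> vw wx P c /(vw P c) /(wx P c). Qed.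

Lemma unsplitC T F P : unsplit T F P -> unsplit T F (~` P).
Proof. by move=> c e /c; rewrite /setC /=; tauto. Qed.

Lemma linked_sym T F v w : linked T F v w -> linked T F w v.
Proof.
move=> vw P c Pw; apply: contrapT => nPv.
exact: (vw _ (unsplitC c) nPv).
Qed.

Lemma linked_end T F e x y : F e -> ends T e x y -> linked T F x y.
Proof. by move=> Fe xy P c; case: (unsplit_ends c Fe xy). Qed.

Lemma linkedS T F F' v w : F `<=` F' -> linked T F v w -> linked T F' v w.
Proof. by move=> s l P c; apply: l => e /s; exact: c. Qed.

Lemma unsplit_linked T F v : unsplit T F (linked T F v).
Proof.
move=> e Fe; split=> l; apply: linked_trans l _; apply: linked_end Fe _.
  by left.
by right.
Qed.

Lemma walk_cat T v p q w :
  walk T v (p ++ q) w <-> exists2 x, walk T v p x & walk T x q w.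
Proof.
elim: p v => [|d p IH] v /=; first by split=> [|[x ->]//]; exists v.
split=> [[-> /IH [x px qx]]|[x [-> px] qx]]; first by exists x.
by split=> //; apply/IH; exists x.
Qed.

Lemma linked_joined T F v w : linked T F v w -> joined T F v w.
Proof.
apply; last by exists [::].
move=> e Fe; have step : forall d, d.1 = e ->
    joined T F v (source T d) -> joined T F v (target T d).
  move=> d de [p vp Fp]; exists (p ++ [:: d]).
    by apply/walk_cat; exists (source T d).
  by move=> d' /List.in_app_iff [/Fp//|[<-|[]]]; rewrite de.
by split=> l; [exact: (step (e, true))|exact: (step (e, false))].
Qed.

Lemma walk_linked T F v p w :
  walk T v p w -> (forall d, List.In d p -> F d.1) -> linked T F v w.
Proof.
elim: p v => [|d p IH] v /=; first by move=> -> _; exact: linked_refl.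
move=> [<- pw] Fp; apply: linked_trans (IH _ pw _); last first.
  by move=> d' d'p; apply: Fp; right.
apply: linked_end (Fp d (or_introl erefl)) _.
by rewrite /source /target; case: d.2; [left|right].
Qed.

Lemma joinedP T F v w : joined T F v w <-> linked T F v w.
Proof. by split=> [[p]|]; [exact: walk_linked|exact: linked_joined]. Qed.

(** A walk with distinct vertices is obtained by cutting out the loops; it
    cannot use an edge twice, as it would then visit an end of it twice. *)
Lemma simple_walk T F v p w :
  walk T v p w -> (forall d, List.In d p -> F d.1) ->
  exists q, [/\ walk T v q w, forall d, List.In d q -> F d.1,
    List.NoDup (map (source T) q ++ [:: w]) & List.NoDup (map fst q)].
Proof.
elim: p v => [|d p IH] v /=.
  move=> -> _; exists [::]; split=> //=; last exact: List.NoDup_nil.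
  by apply: List.NoDup_cons (List.NoDup_nil _); case.
move=> [dv pw] Fp; have [q [qw Fq sq eq]] : exists q,
    [/\ walk T (target T d) q w, forall d, List.In d q -> F d.1,
      List.NoDup (map (source T) q ++ [:: w]) & List.NoDup (map fst q)].
  by apply: IH => // d' d'p; apply: Fp; right.
have [vq|vq] := pselect (List.In v (map (source T) q ++ [:: w])).
  have suffix : forall q x, walk T x q w ->
      List.In v (map (source T) q ++ [:: w]) ->
      exists q1 q2, q = q1 ++ q2 /\ walk T v q2 w.
    elim=> [|c r IHr] x /=; first by move=> _ [->|[]]; exists [::], [::].
    move=> [cx rw] [cv|]; first by exists [::], (c :: r); rewrite /= cv.
    by move=> /(IHr _ rw) [q1 [q2 [-> ?]]]; exists (c :: q1), q2.
  have [q1 [q2 [qE vq2]]] := suffix _ _ qw vq; exists q2; split=> //.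
  - by move=> c cq2; apply: Fq; rewrite qE; apply/List.in_app_iff; right.
  - move: sq; rewrite qE map_cat -catA; move: (map _ q1) => s.
    by elim: s => // a s IHs /= /List.NoDup_cons_iff [_].
  - move: eq; rewrite qE map_cat; move: (map _ q1) => s.
    by elim: s => // a s IHs /= /List.NoDup_cons_iff [_].
exists (d :: q); split=> //=.
- by move=> c [<-|/Fq//]; apply: Fp; left.
- by apply/List.NoDup_cons => //; rewrite dv.
apply/List.NoDup_cons => // dq; apply: vq; rewrite -dv.
(* The edge of [d] occurs in [q]: its two endpoints are then visited. *)
have visit : forall q x, walk T x q w -> List.In d.1 (map fst q) ->
    List.In (source T d) (map (source T) q ++ [:: w]).
  elim=> //= c r IHr x [cx rw] [cd|/(IHr _ rw)]; last by right.
  have [cb|cb] := boolP (c.2 == d.2).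
    by left; rewrite /source cd (eqP cb).
  right; have -> : source T d = target T c.
    by rewrite /source /target cd; case: c.2 d.2 cb => [] [].
  case: (r) rw => [/= ->|b r' /= [<- _]]; by left.
exact: visit qw dq.
Qed.

(** A circuit through [e] amounts to a simple walk between the ends of [e] that
    avoids [e]. *)
Lemma is_treeP T : is_tree T <->
  [/\ exists v : V, True, forall v w, linked T [set: E] v w
    & forall e, ~ linked T ([set: E] `\ e) (ini T e) (ter T e)].
Proof.
split=> [[v0 conn circ]|[v0 conn br]].
split=> //.
- by move=> v w; apply/joinedP.
- move=> e /linked_sym /linked_joined [p pw Fp].
  have [q [qw Fq sq eq]] := simple_walk pw Fp.
  apply: (circ ((e, true) :: q)); split=> //.
  + by exists (ini T e).
  + move: sq => /(List.NoDup_rev) /=; rewrite List.rev_app_distr /=.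
    move=> /List.NoDup_cons_iff [n1 n2]; apply/List.NoDup_cons.
      by move=> n; apply: n1; apply/List.in_rev; rewrite List.rev_involutive.
    by have := List.NoDup_rev n2; rewrite List.rev_involutive.
  + apply/List.NoDup_cons => // /List.in_map_iff [d [de /Fq [_]]].
    by apply.
split=> //.
- by move=> v w; apply/joinedP.
- move=> [[]//|d p] [_ [v [dv pv]] _ /List.NoDup_cons_iff [dp _]].
  have l : linked T ([set: E] `\ d.1) (target T d) (source T d).
    rewrite dv; apply: walk_linked pv _ => c cp; split=> // cd.
    by apply: dp; rewrite -cd; apply: List.in_map.
  apply: (br d.1); move: l; rewrite /source /target; case: d.2 => //.
  exact: linked_sym.
Qed.

Lemma tree_linked T v w : is_tree T -> linked T [set: E] v w.
Proof. by move=> /is_treeP []. Qed.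

Lemma tree_cut T e x y : is_tree T -> ends T e x y ->
  exists P : set V,
    [/\ forall h, h <> e -> P (ini T h) <-> P (ter T h), P x & ~ P y].
Proof.
move=> /is_treeP [_ _ br] xy; exists (linked T ([set: E] `\ e) x).
split=> //; first by move=> h he; apply: unsplit_linked.
case: xy => [[<- <-]//|[<- <-] l]; apply: br; exact: linked_sym l.
Qed.

Lemma cut_tree T :
  (exists v : V, True) ->
  (forall P v w, unsplit T [set: E] P -> P v -> P w) ->
  (forall e, exists P : set V,
    [/\ forall h, h <> e -> P (ini T h) <-> P (ter T h),
        P (ini T e) & ~ P (ter T e)]) ->
  is_tree T.
Proof.
move=> v0 conn cut; apply/is_treeP; split=> //.
  by move=> v w P c; apply: conn.
move=> e l; have [P [c Pi Pt]] := cut e; apply: Pt; apply: l Pi.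
by move=> h [_]; exact: c.
Qed.

(** If [e] and [f] differed, the vertices on the side of [x] for [e] and on the
    side of [v] for [f] would be split by [e] only, whereas [x] and [z] are
    linked without [e]. *)
Lemma first_edge_unique T e f v x y z : is_tree T ->
  ends T e v x -> linked T ([set: E] `\ e) x z ->
  ends T f v y -> linked T ([set: E] `\ f) y z -> e = f.
Proof.
move=> tT evx lx fvy ly; apply: contrapT => ef.
have [P [cP Px Pv]] := tree_cut tT (endsC evx).
have [Q [cQ Qy Qv]] := tree_cut tT (endsC fvy).
have Pz : P z by apply: lx Px => h [_ he]; exact: cP.
have Qz : Q z by apply: ly Qy => h [_ hf]; exact: cQ.
have fe : f <> e by move=> e'; apply: ef.
have nPy : ~ P y.
  move=> Py; apply: Pv.
  have c : unsplit T [set f] P by move=> h ->; exact: cP.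
  exact/(unsplit_ends c erefl fvy).
have cPQ : unsplit T ([set: E] `\ f) (~` P `&` Q).
  move=> h [_ hf]; rewrite /setC /setI /=.
  have [->|he] := pselect (h = e).
    by case: evx => [[-> ->]|[-> ->]]; have := cQ e ef; tauto.
  by have := cP h he; have := cQ h hf; tauto.
by have [] : (~` P `&` Q) z by apply: ly.
Qed.

Inductive edge_path T F : nat -> V -> V -> Prop :=
| path0 v : edge_path T F 0 v v
| pathS n e x y z : F e -> ends T e x y -> edge_path T F n y z ->
    edge_path T F n.+1 x z.

Lemma path_linked T F n v w : edge_path T F n v w -> linked T F v w.
Proof.
elim=> {n v w} [v|n e x y z Fe xy _]; first exact: linked_refl.
apply: linked_trans.
exact: linked_end Fe xy.
Qed.

Lemma linked_path T F v w : linked T F v w -> exists n, edge_path T F n v w.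
Proof.
move=> /linked_sym l; pose P x := exists n, edge_path T F n x w.
have c : unsplit T F P.
  move=> e Fe; split=> -[n p]; exists n.+1; apply: (pathS Fe _ p).
    by right.
  by left.
by apply: (l P c); exists 0%N; exact: path0.
Qed.

Lemma path_avoid T F n v w e : edge_path T F n v w ->
  edge_path T (F `\ e) n v w \/
  exists x y m, [/\ (m < n)%N, ends T e x y & edge_path T F m y w].
Proof.
elim=> {n v w} [v|n f x y z Ff xy p IH]; first by left; exact: path0.
have [fe|fe] := pselect (f = e).
  by right; exists x, y, n; rewrite -fe.
case: IH => [q|[x' [y' [m [mn xy' q]]]]]; first by left; apply: (pathS _ xy q).
by right; exists x', y', m; split=> //; apply: ltnW.
Qed.

Lemma ends_uniq T e x y x' y' : ends T e x y -> ends T e x' y' ->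
  (x' = x /\ y' = y) \/ (x' = y /\ y' = x).
Proof. by case=> [[<- <-]|[<- <-]] [[<- <-]|[<- <-]]; auto. Qed.

(** At each vertex of the geodesic from [v] to [w], only one edge leads towards
    [w]; an element that fixes [w] and the vertex hence fixes this edge, and
    then the next vertex. *)
Lemma linked_fixed T F H v w : is_tree T ->
  H `<=` stab v -> H `<=` stab w -> linked T F v w ->
  linked T (F `&` [set e | H `<=` stab e]) v w.
Proof.
move=> tT Hv Hw /linked_path [n]; elim/ltn_ind: n v Hv => n IH v Hv p.
(* If the path comes back to its first edge, there is a shorter path from
   [x] to [z], to which the induction hypothesis applies. *)
move: IH Hv Hw; case: n v w / p => [v _ _ _|n e x y z Fe xy p IH Hx Hz].
  exact: linked_refl.
have [q|[x' [y' [m [mn xy' q]]]]] := path_avoid e p; last first.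
  case: (ends_uniq xy xy') => [[_ yE]|[_ yE]]; rewrite {}yE in q.
    by apply: (IH m.+1 _ _ Hx (pathS Fe xy q)); rewrite ltnS.
  by apply: (IH m _ _ Hx q); rewrite ltnS ltnW.
have He : H `<=` stab e.
  move=> g Hg; rewrite /stab /=; apply: esym.
  have xyg := ends_act g xy; rewrite (Hx g Hg) in xyg.
  have l : linked T ([set: E] `\ e) y z.
    by apply: linkedS (path_linked q) => h [].
  apply: (first_edge_unique tT xy l xyg).
  move=> P c; rewrite -(Hz g Hg) => Py.
  pose Q := [set v | P (act g v)].
  apply: (l Q _ Py) => h [_ he].
  rewrite /Q /= -ini_equivariant -ter_equivariant.
  by apply: c; split=> // /act_inj.
have Hy : H `<=` stab y by apply: subset_trans He (stab_end (endsC xy)).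
apply: linked_trans (IH n _ y Hy p) => //.
by apply: linked_end xy; split.
Qed.

End Linked.

(** * Sliding an orbit of edges *)

Section Sliding.
Variables (G : groupType) (V E : gset G).
Implicit Types (T : ggraph V E) (e f h : E) (x y z : V) (P : set V).

Section Reorient.
Variables (D : gsubset E) (T : ggraph V E).

Let flip_ini e := if `[< (D : set E) e >] then ter T e else ini T e.
Let flip_ter e := if `[< (D : set E) e >] then ini T e else ter T e.

Lemma flip_ini_equivariant : equivariant flip_ini.
Proof.
move=> g e; rewrite /flip_ini (asbool_equiv_eq (gsubset_actE D g e)).
by rewrite ini_equivariant ter_equivariant; case: asboolP.
Qed.

Lemma flip_ter_equivariant : equivariant flip_ter.
Proof.
move=> g e; rewrite /flip_ter (asbool_equiv_eq (gsubset_actE D g e)).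
by rewrite ini_equivariant ter_equivariant; case: asboolP.
Qed.

Definition flip : ggraph V E :=
  GGraph flip_ini_equivariant flip_ter_equivariant.

Lemma flipE e :
  ((D : set E) e -> ini flip e = ter T e /\ ter flip e = ini T e) /\
  (~ (D : set E) e -> ini flip e = ini T e /\ ter flip e = ter T e).
Proof. by rewrite /= /flip_ini /flip_ter; case: asboolP. Qed.

Lemma reorients_flip : reorients D T flip.
Proof. exact: flipE. Qed.

Lemma ends_flip e x y : ends flip e x y <-> ends T e x y.
Proof.
have [i n] := flipE e; rewrite /ends.
by have [/i [-> ->]|/n [-> ->]] := pselect ((D : set E) e); tauto.
Qed.

Lemma unsplit_flip F P : unsplit flip F P <-> unsplit T F P.
Proof.
split=> c e Fe.
  by apply: (unsplit_ends c Fe); apply/ends_flip; exact: ends_ini.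
by apply: (unsplit_ends c Fe); apply/ends_flip; exact: ends_ini.
Qed.

Lemma linked_flip F x y : linked flip F x y <-> linked T F x y.
Proof. by split=> l P c; apply: l; exact/unsplit_flip. Qed.

Lemma is_tree_flip : is_tree T -> is_tree flip.
Proof.
move=> /is_treeP [v0 conn br]; apply/is_treeP; split=> // [v w|e].
  exact/linked_flip.
move=> /linked_flip l; apply: (br e); have [i n] := flipE e.
have [/i [iE tE]|/n [iE tE]] := pselect ((D : set E) e);
  by rewrite iE tE in l => //; exact: linked_sym.
Qed.

End Reorient.

(** A cut of [T] at an edge [a] outside the orbit of [f] is still one after the
    slide, because it separates the old ends of a translate of [e] exactly when
    it separates the new ones.  Only the cuts at translates of [f] have to be
    corrected. *)
Lemma slide_oriented T e f : is_tree T ->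
  ter T e = ini T f -> stab e `<=` stab f -> ~ orbit e f ->
  exists T', slides e f T T' /\ is_tree T'.
Proof.
move=> tT ef sef nef.
have gef : forall g k : G, act g e = act k e -> act g f = act k f.
  by move=> g k /eq_stab /sef /stab_eq.
pose t e' := if pselect (orbit e e') is left o then
  ter T (act (sval (cid2 o)) f) else ter T e'.
have tO g : t (act g e) = ter T (act g f).
  rewrite /t; case: pselect => [o|[]]; last exact: orbit_act.
  by case: cid2 => k _ /= /gef ->.
have tN e' : ~ orbit e e' -> t e' = ter T e' by rewrite /t; case: pselect.
have teq : equivariant t.
  move=> g e'; have [[k _ <-]|o] := pselect (orbit e e').
    by rewrite -actM !tO actM ter_equivariant.
  by rewrite !tN // ?ter_equivariant // orbit_actE.
pose T' := GGraph (ini_equivariant T) teq; exists T'; split.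
  split; split=> //.
  apply/seteqP; split=> // h [fh eh]; apply: nef.
  exact: orbit_trans eh (orbit_sym fh).
have neq (g k : G) : act g f <> act k e.
  move=> gk; apply: nef; apply/(orbit_actE _ _ g); rewrite gk; exact: orbit_act.
have efg g : ter T (act g e) = ini T (act g f).
  by rewrite ini_equivariant ter_equivariant ef.
have tT' := tT; move/is_treeP: tT' => [v0 conn _].
apply: cut_tree => //.
  move=> P v w c; apply: conn => h _.
  have [[g _ <-]|o] := pselect (orbit e h).
    have := c (act g e) I; rewrite /= tO => ->; rewrite efg.
    have := c (act g f) I; rewrite /= tN => [->//|].
    by move=> [k _ /esym /neq].
  by have := c h I; rewrite /= tN.
move=> a.
have [Q [cQ Qi Qt]] := tree_cut tT (ends_ini T a).
have cQ' : forall h, ~ orbit e h -> h <> a -> Q (ini T' h) <-> Q (ter T' h).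
  by move=> h o ha; rewrite /= tN //; exact: cQ.
have [|nfa] := pselect (orbit f a).
  case=> g0 _ aE; subst a; set a := act g0 f in Q cQ Qi Qt cQ' *.
  (* [Q] separates the ends of [a], but also the new ends of the translates
     of [e] slid along [a]: the parts of the tree beyond these translates
     are removed from [Q]. *)
  have cut h : exists C : set V,
      [/\ forall h', h' <> h -> C (ini T h') <-> C (ter T h'),
        C (ter T h) & ~ C (ini T h)].
    exact: tree_cut tT (endsC (ends_ini T h)).
  have {cut} [C CP] := choice cut.
  pose P v := Q v /\ forall g, act g f = a -> C (act g e) v.
  exists P; split.
  - move=> h ha; have [[g _ <-]|o] := pselect (orbit e h); last first.
      rewrite /P /= tN //; have := cQ h ha.
      have Ch g : C (act g e) (ini T h) <-> C (act g e) (ter T h).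
        have [c _ _] := CP (act g e); apply: c => he; apply: o; rewrite he.
        exact: orbit_act.
      move=> ->; split=> -[? H]; split=> // g /H; by rewrite Ch.
    rewrite /= tO; have [ga|ga] := pselect (act g f = a).
      rewrite ga; split=> [[_ /(_ g ga)]|[]//].
      by have [_ _ nC] := CP (act g e) => /nC.
    have ne : act g e <> a by move/esym; exact: neq.
    have := cQ _ ne; rewrite efg; have := cQ _ ga => Q2 Q1; rewrite /P Q1 Q2.
    have Ck k : act k f = a ->
        C (act k e) (ini T (act g e)) <-> C (act k e) (ter T (act g f)).
      move=> ka; have [c _ _] := CP (act k e).
      rewrite c ?efg ?(c (act g f)) //.
      by move=> gk; apply: ga; rewrite (gef g k).
    by split=> -[? H]; split=> // k ka; apply/(Ck k ka); exact: H.
  - split=> // g ga; have [_ + _] := CP (act g e).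
    by rewrite efg ga.
  - by rewrite /= tN => [[]//|]; move=> [k _ /esym /neq].
exists Q; have sep : forall g, Q (ini T (act g f)) <-> Q (ter T (act g f)).
  by move=> g; apply: cQ => fa; apply: nfa; rewrite -fa; exact: orbit_act.
split=> //.
- move=> h ha; have [[g _ gh]|o] := pselect (orbit e h); last exact: cQ'.
  by subst h; rewrite /= tO -sep -efg; exact: cQ.
- have [[g _ ga]|o] := pselect (orbit e a); last by rewrite /= tN.
  by subst a; rewrite /= tO -sep -efg.
Qed.

Lemma slide_exists (T : gtree V E) e f x y z :
  ends T e x y -> ends T f y z -> stab e `<=` stab f -> ~ orbit e f ->
  exists T' : gtree V E, [/\ sliding_operation T T', ends T' e x z &
    forall h, ~ orbit e h -> ini T' h = ini T h /\ ter T' h = ter T h].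
Proof.
move=> exy fyz sef nef.
have nfe : ~ orbit f e by move/orbit_sym.
have [be beP] : exists be : bool,
    if be then ini T e = y /\ ter T e = x else ini T e = x /\ ter T e = y.
  by case: exy; [exists false|exists true].
have [bf bfP] : exists bf : bool,
    if bf then ini T f = z /\ ter T f = y else ini T f = y /\ ter T f = z.
  by case: fyz; [exists false|exists true].
pose D0 : set E := [set h | (be /\ orbit e h) \/ (bf /\ orbit f h)].
have DA g h : D0 h -> D0 (act g h).
  by rewrite /D0 /= !orbit_actE.
pose D := GSubset DA.
have De : D0 e <-> be.
  split=> [[[]//|[_ /nfe]//]|b]; left; split=> //; exact: orbit_refl.
have Df : D0 f <-> bf.
  split=> [[[_ /nef]//|[]//]|b]; right; split=> //; exact: orbit_refl.
have [i1 t1] : ini (flip D T) e = x /\ ter (flip D T) e = y.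
  have [a b] := flipE D T e.
  case: ifP beP => eb [<- <-]; first exact/a/De.
  by apply: b => /De; rewrite eb.
have [i2 t2] : ini (flip D T) f = y /\ ter (flip D T) f = z.
  have [a b] := flipE D T f.
  case: ifP bfP => eb [<- <-]; first exact/a/Df.
  by apply: b => /Df; rewrite eb.
have tT1 := is_tree_flip D (gtree_is_tree T).
have tf : ter (flip D T) e = ini (flip D T) f by rewrite t1 i2.
have [T2 [sl tT2]] := slide_oriented tT1 tf sef nef.
exists (GTree (is_tree_flip D tT2)); split.
- exists e, f, D0, (flip D T), T2; split; last first.
    by split=> //; exact: reorients_flip D _.
  rewrite /D0; case: (be) (bf) => [] [].
  + apply: Or44; apply/seteqP.
    by split=> h /=; [case=> -[_]; [left|right]|case; [left|right]].
  + apply: Or42; apply/seteqP.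
    by split=> h /=; [case=> -[]|left].
  + apply: Or43; apply/seteqP.
    by split=> h /=; [case=> -[]|right].
  + by apply: Or41; apply/seteqP; split=> h //= -[[]|[]].
- apply/ends_flip; left; have [_ [-> tg _]] := sl; split=> //.
  by have := tg 1; rewrite !act1 t2.
move=> h nh; have [_ [ih _ th]] := sl.
have [a b] := flipE D T2 h; have [c d] := flipE D T h.
rewrite ih th // in a b.
have [Dh|Dh] := pselect ((D : set E) h).
  by have [-> ->] := a Dh; have [-> ->] := c Dh.
by have [-> ->] := b Dh; have [-> ->] := d Dh.
Qed.

End Sliding.

(** * Transfinite sequences of slides *)

Section Runs.
Variables (G : groupType) (V E : gset G) (T0 : gtree V E).

(** The counter of moves makes the successive stages of a sequence pairwise
    distinct and orders them, so that a transfinite sequence can be represented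
    by the mere set of its stages. *)
Record stage := Stage { tree_of :> gtree V E; moves : E -> nat }.

Implicit Types (s a b c : stage) (R : set stage) (e h : E).

Definition same s s' e : Prop :=
  [/\ ini s' e = ini s e, ter s' e = ter s e & moves s' e = moves s e].

Definition earlier s s' : Prop :=
  forall e, (moves s e < moves s' e)%N \/ same s s' e.

Lemma same_refl s e : same s s e.
Proof. by []. Qed.

Lemma same_sym s s' e : same s s' e -> same s' s e.
Proof. by case. Qed.

Lemma same_trans s s' s'' e : same s s' e -> same s' s'' e -> same s s'' e.
Proof.
by move=> [i t m] [i' t' m']; split; [rewrite i'|rewrite t'|rewrite m'].
Qed.

Lemma earlier_refl s : earlier s s.
Proof. by move=> e; right. Qed.

Lemma earlier_trans s s' s'' :
  earlier s s' -> earlier s' s'' -> earlier s s''.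
Proof.
move=> ss' ss'' e; case: (ss' e) => [l|m]; case: (ss'' e) => [l'|m'].
- by left; apply: ltn_trans l l'.
- by left; case: m' => _ _ ->.
- by left; case: m => _ _ <-.
- by right; apply: same_trans m m'.
Qed.

Lemma same_between s s' s'' e :
  earlier s s' -> earlier s' s'' -> same s s'' e ->
  same s s' e /\ same s' s'' e.
Proof.
move=> /(_ e) ss' /(_ e) ss'' m; have [_ _ mE] := m.
case: ss' ss'' => [l|m'] [l'|m''].
- by have := ltn_trans l l'; rewrite mE ltnn.
- by case: m'' => _ _ m2; rewrite -m2 mE ltnn in l.
- by case: m' => _ _ m2; rewrite m2 mE ltnn in l'.
by [].
Qed.

Lemma stage_eq s s' : (forall e, same s s' e) -> s = s'.
Proof.
case: s s' => [[[i t ie te] tT] m] [[[i' t' ie' te'] tT'] m'] eq.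
have ei : i' = i by apply/funext => e; case: (eq e).
have et : t' = t by apply/funext => e; case: (eq e).
have em : m' = m by apply/funext => e; case: (eq e).
clear eq; subst i' t' m'.
rewrite (Prop_irrelevance ie' ie) (Prop_irrelevance te' te) in tT' *.
by rewrite (Prop_irrelevance tT' tT).
Qed.

Lemma earlier_anti s s' : earlier s s' -> earlier s' s -> s = s'.
Proof.
move=> ss' s's; apply: stage_eq => e.
exact: (proj1 (same_between ss' s's (same_refl s e))).
Qed.

Definition start : stage := Stage T0 (fun=> 0%N).

(** Since [earlier] well-orders it, [R] stands for a transfinite sequence; the
    clauses on successors and limits tell apart the stages that have an
    immediate predecessor in [R] and those that have none. *)
Record is_run R s : Prop := IsRun {
  run_start : R start;
  run_end : R s;
  run_bounds : forall a, R a -> earlier start a /\ earlier a s;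
  run_wf : forall A : set stage, A `<=` R -> A !=set0 ->
    exists2 a, A a & forall b, A b -> earlier a b;
  run_succ : forall a b, R a -> R b -> earlier a b -> a <> b ->
    (forall c, R c -> earlier a c -> earlier c b -> c = a \/ c = b) ->
    sliding_operation a b;
  run_limit : forall b, R b -> b <> start ->
    (forall a, R a -> earlier a b -> a <> b ->
       exists c, [/\ R c, earlier a c, earlier c b, c <> a & c <> b]) ->
    forall e, exists c, [/\ R c, earlier c b, c <> b & same c b e]
}.

Lemma run_total R s a b :
  is_run R s -> R a -> R b -> earlier a b \/ earlier b a.
Proof.
move=> rR Ra Rb.
have [||c] := run_wf rR (A := [set x | x = a \/ x = b]).
- by move=> x [->|->].
- by exists a; left.
by case=> -> l; [left; apply: l; right|right; apply: l; left].
Qed.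

Lemma run_initial : is_run [set start] start.
Proof.
split=> //.
- by move=> _ ->; split; exact: earlier_refl.
- move=> A AR [a Aa]; exists a => // b /AR ->.
  by rewrite (AR _ Aa); exact: earlier_refl.
- by move=> _ _ -> ->.
Qed.

Lemma run_append R s s' : is_run R s -> sliding_operation s s' ->
  earlier s s' -> s <> s' -> is_run (R `|` [set s']) s'.
Proof.
move=> rR sl ss' ns; have toS a : R a -> earlier a s by case/(run_bounds rR).
have Rs' : ~ R s' by move=> /toS s's; apply: ns; exact: earlier_anti.
split.
- by left; exact: run_start rR.
- by right.
- move=> a [/[dup] /(run_bounds rR) [? as'] _|->]; split=> //.
  + exact: earlier_trans as' ss'.
  + by apply: earlier_trans ss'; case: (run_bounds rR (run_end rR)).
  + exact: earlier_refl.
- move=> A AR [a Aa]; have [[b [Ab Rb]]|nA] := pselect (A `&` R !=set0).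
    have [||m [Am Rm] mP] := run_wf rR (A := A `&` R); first by move=> x [].
      by exists b.
    exists m => // x Ax; have [Rx|->] := AR x Ax; first exact: mP.
    exact: earlier_trans (toS _ Rm) ss'.
  have As' x : A x -> x = s'.
    by move=> Ax; case: (AR x Ax) => // Rx; case: nA; exists x.
  by exists a => // b Ab; rewrite (As' a) // (As' b) //; exact: earlier_refl.
- move=> a b [Ra|->] [Rb|->] ab nab mid.
  + by apply: (run_succ rR) => // c Rc; apply: mid; left.
  + suff -> : a = s by [].
    by case: (mid s) => //; [left; exact: run_end rR|exact: toS].
  + case: nab; apply: earlier_anti => //.
    exact: earlier_trans (toS _ Rb) ss'.
  + by [].
- move=> b [Rb|->] nb lim e.
    have [|c [Rc cb nc m]] := run_limit rR Rb nb _ e; last first.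
      by exists c; split=> //; left.
    move=> a Ra ab nab.
    have [|c [Rc ac cb nca ncb]] := lim a _ ab nab; first by left.
    exists c; split=> //; case: Rc cb => // -> s'b; case: Rs'.
    by rewrite (earlier_anti s'b _) //; apply: earlier_trans (toS _ Rb) ss'.
  have [|c [Rc sc cs' ncs ncs']] := lim s _ ss' ns.
    by left; exact: run_end rR.
  by case: Rc ncs' => [/toS cs|->//]; case: ncs; exact: earlier_anti.
Qed.

(** End extension of runs, each one being given with its last stage. *)
Definition extends (p q : set stage * stage) : Prop :=
  p.1 `<=` q.1 /\ forall a, q.1 a -> p.1 a \/ earlier p.2 a.

Lemma extends_earlier p q : is_run p.1 p.2 -> is_run q.1 q.2 ->
  extends p q -> earlier p.2 q.2.
Proof. by move=> rp rq [pq _]; case: (run_bounds rq (pq _ (run_end rp))). Qed.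

Lemma extends_refl p : extends p p.
Proof. by split=> // a; left. Qed.

Lemma extends_trans p q r : is_run p.1 p.2 -> is_run q.1 q.2 ->
  extends p q -> extends q r -> extends p r.
Proof.
move=> rp rq pq [qr1 qr2]; have pqe := extends_earlier rp rq pq.
case: pq => pq1 pq2; split; first exact: subset_trans qr1.
move=> a /qr2 [/pq2 //|qa]; right; exact: earlier_trans pqe qa.
Qed.

Lemma extends_down p q a b : is_run p.1 p.2 -> extends p q ->
  p.1 b -> q.1 a -> earlier a b -> p.1 a.
Proof.
move=> rp [_ pq] pb /pq [//|pa] ab; have [_ bp] := run_bounds rp pb.
by have -> : a = b by apply: earlier_anti (ab) (earlier_trans bp pa).
Qed.

(** The stage [s] is the limit of the last stages of the runs in [C]; it need
    not be a new stage, since the chain [C] may have a last element. *)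
Lemma run_union (C : set (set stage * stage)) s : C !=set0 ->
  (forall p, C p -> is_run p.1 p.2) ->
  (forall p q, C p -> C q -> extends p q \/ extends q p) ->
  (forall p, C p -> earlier p.2 s) ->
  (forall e, exists2 p, C p & same p.2 s e) ->
  is_run ((\bigcup_(p in C) p.1) `|` [set s]) s.
Proof.
move=> [p0 Cp0] rC tC eC lC; set R := \bigcup_(p in C) p.1.
have toS a : R a -> earlier a s.
  move=> [p Cp pa]; apply: earlier_trans (eC _ Cp).
  by case: (run_bounds (rC p Cp) pa).
have down p a b : C p -> p.1 b -> R a -> earlier a b -> p.1 a.
  move=> Cp pb [q Cq qa] ab; have [pq|[qp _]] := tC p q Cp Cq; last exact: qp.
  exact: extends_down (rC p Cp) pq pb qa ab.
have startR : R start by exists p0 => //; exact: run_start (rC p0 Cp0).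
have RS : forall a, (R `|` [set s]) a -> earlier a s.
  by move=> a [/toS|->]; last exact: earlier_refl.
split.
- by left.
- by right.
- move=> a aR; split; last exact: RS.
  case: aR => [[p Cp /(run_bounds (rC p Cp)) []]//|->].
  exact: toS.
- move=> A AR [a Aa]; have [[b [Ab [p Cp pb]]]|nA] := pselect (A `&` R !=set0).
    have [||m [Am pm] mP] := run_wf (rC p Cp) (A := A `&` p.1).
      by move=> x [].
      by exists b.
    exists m => // x Ax; have [Rx|->] := AR x Ax; last first.
      by apply: toS; exists p.
    have [q [Cq qx pq]] : exists q, [/\ C q, q.1 x & extends p q].
      have [q Cq qx] := Rx; have [pq|[qp _]] := tC p q Cp Cq; first by exists q.
      by exists p; split=> //; [exact: qp|exact: extends_refl].
    have [pq1 _] := pq; have qm := pq1 _ pm.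
    have [//|xm] := run_total (rC q Cq) qm qx.
    by apply: mP; split=> //; apply: down pm Rx xm.
  have As x : A x -> x = s.
    by move=> Ax; case: (AR x Ax) => // Rx; case: nA; exists x.
  by exists a => // b Ab; rewrite (As a) // (As b) //; exact: earlier_refl.
- move=> a b aR bR ab nab mid.
  have [[p Cp pb]|nb] := pselect (R b).
    have Ra : R a.
      case: aR => // as_; case: nab; apply: earlier_anti ab _.
      by rewrite as_; apply: toS; exists p.
    apply: (run_succ (rC p Cp)) => //; first exact: down pb Ra ab.
    by move=> c pc; apply: mid; left; exists p.
  have {bR} bs : b = s by case: bR. subst b.
  have Ra : R a by case: aR => // as_; case: nab.
  (* Otherwise all the runs in [C] would have ended at [a]. *)
  have top p : C p -> earlier p.2 a.
    move=> Cp; have pR : R p.2 by exists p => //; exact: run_end (rC p Cp).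
    have [q [Cq qa qp]] : exists q, [/\ C q, q.1 a & q.1 p.2].
      have [q Cq qa] := Ra; have [[pq _]|[qp _]] := tC p q Cp Cq.
        by exists q; split=> //; apply: pq; exact: run_end (rC p Cp).
      by exists p; split=> //; [exact: qp|exact: run_end (rC p Cp)].
    have [ap|//] := run_total (rC q Cq) qa qp.
    have [|->|pS] := mid p.2 _ ap (eC p Cp); first by left.
      exact: earlier_refl.
    by case: nb; rewrite -pS.
  case: nab; apply: stage_eq => e; have [p Cp m] := lC e.
  by case: (same_between (top p Cp) ab m).
- move=> b bR nb limb e.
  have [[p Cp pb]|nRb] := pselect (R b).
    have [|c [pc cb ncb m]] := run_limit (rC p Cp) pb nb _ e; last first.
      by exists c; split=> //; left; exists p.
    move=> a pa ab nab; have [|c [cR ac cb nca ncb]] := limb a _ ab nab.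
      by left; exists p.
    exists c; split=> //; apply: (down p c b Cp pb) => //.
    case: cR cb ncb => // -> sb; case; apply: earlier_anti sb _.
    by apply: toS; exists p.
  have {bR} bs : b = s by case: bR. subst b.
  have [p Cp m] := lC e; exists p.2; split=> //; [|exact: eC|].
    by left; exists p => //; exact: run_end (rC p Cp).
  move=> pS; apply: nRb; exists p => //.
  by rewrite -pS; exact: run_end (rC p Cp).
Qed.

Lemma extends_union (C : set (set stage * stage)) s p :
  (forall p, C p -> is_run p.1 p.2) ->
  (forall p q, C p -> C q -> extends p q \/ extends q p) ->
  earlier p.2 s -> C p ->
  extends p ((\bigcup_(p in C) p.1) `|` [set s], s).
Proof.
move=> rC tC ps Cp; split=> /= [a pa|a [[q Cq qa]|->]]; last by right.
  by left; exists p.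
by have [[_ /(_ a qa)]|[/(_ a qa) pa _]] := tC p q Cp Cq; [|left].
Qed.

Lemma run_sequence R s : is_run R s -> sliding_sequence T0 s.
Proof.
move=> rR; pose I := {a : stage | R a}.
pose le : rel I := fun a b : I => `[< earlier (sval a) (sval b) >].
pose o : I := exist _ start (run_start rR).
pose l : I := exist _ s (run_end rR).
have sval_inj (a b : I) : sval a = sval b -> a = b.
  by case: a b => a Ra [b Rb] /= ab; subst b; rewrite (Prop_irrelevance Ra Rb).
have ltP (a b : I) :
    wo_lt le a b <-> earlier (sval a) (sval b) /\ sval a <> sval b.
  split=> -[/asboolP ab nab]; split=> //; first by move=> /sval_inj.
  by move=> ba; apply: nab; rewrite ba.
exists I, le, o, l, (fun a : I => sval a); split; first split.
- move=> A [a Aa].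
  pose B : set stage := [set x | exists2 b : I, b \in A & sval b = x].
  have [||_ [m Am <-] mP] := run_wf rR (A := B).
  + by move=> _ [b _ <-]; exact: (svalP b).
  + by exists (sval a), a.
  exists m; split; first by split=> // b Ab; apply/asboolP/mP; exists b.
  move=> m' [Am' m'P]; apply: sval_inj; apply: earlier_anti.
    by apply: mP; exists m'.
  by apply/asboolP; exact: m'P.
- by move=> a; apply/asboolP; case: (run_bounds rR (svalP a)).
- by move=> a; apply/asboolP; case: (run_bounds rR (svalP a)).
split=> //.
- move=> a b [/ltP [ab nab] mid].
  apply: (run_succ rR) (svalP a) (svalP b) ab nab _.
  move=> c Rc ac cb; apply: contrapT => nc; apply: (mid (exist _ c Rc)).
  by split; apply/ltP; split=> //= ce; apply: nc; [left|right].
- move=> b [[a0 /ltP [ab0 nab0]] lim] e.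
  have nb : sval b <> start.
    move=> bs; apply: nab0; apply: earlier_anti ab0 _; rewrite bs.
    by case: (run_bounds rR (svalP a0)).
  have [|c [Rc cb ncb m]] := run_limit rR (svalP b) nb _ e.
    move=> a Ra ab nab; apply: contrapT => nc.
    apply: (lim (exist _ a Ra)); split; first exact/ltP.
    move=> c [/ltP [/= ac nac] /ltP [cb ncb]]; apply: nc; exists (sval c).
    by split=> //; [exact: svalP|move/esym].
  exists (exist _ c Rc); first exact/ltP.
  move=> a /asboolP ca /ltP [ab _].
  by have [_ [-> -> _]] := same_between ca ab m.
Qed.

End Runs.

(** * Absorbing a vertex into the retract *)

Section States.
Variables (G : groupType) (V E : gset G) (T0 : gtree V E) (U : gsubset V).

Notation inU := (gsubset_set U).

(** [merged] is the set of the edges of [now] to be compressed, and [rep] sends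
    each vertex to the vertex that its component will be compressed to.  The
    compressed tree, with the vertices fixed by [rep] and the edges outside
    [merged], is never constructed; [cends] gives the ends of its edges. *)
Record state := State {
  run : set (stage V E);
  now : stage V E;
  merged : set E;
  rep : V -> V
}.

Implicit Types (s t : state) (e f h : E) (v w x y z p q : V).

Definition cends s e x y : Prop :=
  exists p q, [/\ ends (now s) e p q, rep s p = x & rep s q = y].

(** The edges that cannot be merged.  Merging and sliding other edges preserves
    this property: the stabilizers of the ends can only grow, and ends in
    the same orbit stay in the same orbit ([frozenS]). *)
Definition rigid s e : Prop := forall x y, cends s e x y ->
  ~ inU x -> stab x `<=` stab e -> orbit x y.

Definition frozen s : set E := [set e | merged s e \/ rigid s e].

(** The last clause is what keeps limits connected: the ends in [T0] of any edge
    are still linked by that edge together with edges that no longer move. *)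
Record good s : Prop := Good {
  good_run : is_run T0 (run s) (now s);
  merged_act : forall g e, merged s e -> merged s (act g e);
  rep_act : equivariant (rep s);
  rep_idem : forall v, rep s (rep s v) = rep s v;
  rep_inU : forall v, inU v -> rep s v = v;
  merged_rep : forall e, merged s e ->
    rep s (ini (now s) e) = rep s (ter (now s) e);
  rep_linked : forall v, linked (now s) (merged s) v (rep s v);
  good_origin : forall e P, unsplit (now s) (frozen s `|` [set e]) P ->
    (P (ini T0 e) <-> P (ter T0 e))
}.

Arguments rep_linked {s} _ v P _ _.

(** The last clause makes positions converge along chains: an edge moves only if
    it is merged afterwards, and it is frozen from then on. *)
Definition evolves s t : Prop :=
  [/\ extends (run s, now s) (run t, now t), merged s `<=` merged t,
      forall v, rep t (rep s v) = rep t v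
    & forall e, same (now s) (now t) e \/ (~ frozen s e /\ merged t e)].

Lemma inU_act g v : inU (act g v) <-> inU v.
Proof. exact: gsubset_actE. Qed.

Lemma cendsC s e x y : cends s e x y -> cends s e y x.
Proof. by move=> [p [q [/endsC pq px qy]]]; exists q, p. Qed.

Lemma cends_act s e x y g : good s ->
  cends s e x y -> cends s (act g e) (act g x) (act g y).
Proof.
move=> gs [p [q [/(ends_act g) pq <- <-]]].
by exists (act g p), (act g q); split=> //; rewrite (rep_act gs).
Qed.

Lemma cends_uniq s e x y x' y' : cends s e x y -> cends s e x' y' ->
  (x' = x /\ y' = y) \/ (x' = y /\ y' = x).
Proof.
move=> [p [q [pq <- <-]]] [p' [q' [pq' <- <-]]].
by case: (ends_uniq pq pq') => -[-> ->]; [left|right].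
Qed.

Lemma stab_cend s e x y : good s -> cends s e x y -> stab e `<=` stab x.
Proof.
move=> gs [p [q [pq <- _]]]; apply: subset_trans (stab_end pq) _.
by apply: stab_map; exact: rep_act gs.
Qed.

Lemma cends_fix s e x y : good s -> cends s e x y -> rep s x = x.
Proof. by move=> gs [p [q [_ <- _]]]; exact: rep_idem gs _. Qed.

Lemma cends_merged s e x y : good s -> merged s e -> cends s e x y -> x = y.
Proof.
by move=> gs /(merged_rep gs) m [p [q [[[<- <-]|[<- <-]] <- <-]]].
Qed.

Lemma merged_orbit s e h : good s -> orbit e h -> merged s h -> merged s e.
Proof.
by move=> gs [g _ <-] /(merged_act gs g^-1); rewrite actK.
Qed.

Lemma rigid_orbit s e h : good s -> orbit e h -> rigid s h -> rigid s e.
Proof.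
move=> gs [g _ <-] r x y xy nx sx.
have := r _ _ (cends_act g gs xy); rewrite inU_act => /(_ nx (stab_actS sx)).
move=> o; apply/(orbit_actE _ _ g); exact: orbit_trans (orbit_act _ _) o.
Qed.

Lemma frozen_orbit s e h : good s -> orbit e h -> frozen s h -> frozen s e.
Proof.
move=> gs o [m|r]; first by left; exact: merged_orbit o m.
by right; exact: rigid_orbit o r.
Qed.

Lemma frozenS s t e : good s -> equivariant (rep t) ->
  (forall v, inU v -> rep t v = v) ->
  merged s `<=` merged t -> (forall v, rep t (rep s v) = rep t v) ->
  same (now s) (now t) e -> frozen s e -> frozen t e.
Proof.
move=> gs et Ut mst rst [i tE _] [m|r]; first by left; exact: mst.
right=> x y [p [q [pq <- <-]]] nx sx.
have pq' : cends s e (rep s p) (rep s q).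
  by exists p, q; split=> //; move: pq; rewrite /ends i tE.
have [||g _ gE] := r _ _ pq'.
- by move=> u; apply: nx; rewrite -rst Ut.
- by apply: subset_trans sx; rewrite -[rep t p]rst; exact: stab_map.
by exists g => //; rewrite -[rep t q]rst -gE et rst.
Qed.

Lemma frozen_good s t e : good s -> good t ->
  merged s `<=` merged t -> (forall v, rep t (rep s v) = rep t v) ->
  same (now s) (now t) e -> frozen s e -> frozen t e.
Proof.
by move=> gs gt; apply: frozenS => //; [exact: rep_act gt|exact: rep_inU gt].
Qed.

Lemma evolves_refl s : good s -> evolves s s.
Proof.
move=> gs; split=> //; first exact: extends_refl.
  exact: rep_idem gs.
by move=> e; left; exact: same_refl.
Qed.

Lemma frozen_same s t e : evolves s t -> frozen s e -> same (now s) (now t) e.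
Proof. by move=> [_ _ _ /(_ e) [//|[]]]. Qed.

Lemma evolves_frozen s t e : good s -> good t -> evolves s t ->
  frozen s e -> frozen t e.
Proof.
move=> gs gt st fe; have [_ mst rst _] := st.
exact: frozen_good gs gt mst rst (frozen_same st fe) fe.
Qed.

Lemma evolves_trans s t r : good s -> good t -> good r ->
  evolves s t -> evolves t r -> evolves s r.
Proof.
move=> gs gt gr st tr.
have [est mst rst sst] := st; have [etr mtr rtr str] := tr.
split.
- apply: (@extends_trans _ _ _ T0 _ (run t, now t)) => //; exact: good_run.
- exact: subset_trans mst mtr.
- by move=> v; rewrite -rtr rst rtr.
move=> e; case: (sst e) => [ste|[nf m]].
  case: (str e) => [tre|[nf m]]; first by left; exact: same_trans ste tre.
  right; split=> // fe; apply: nf; exact: evolves_frozen fe.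
by right; split=> //; exact: mtr.
Qed.

(** The orbits in the list are still to be absorbed; a finite list suffices
    because an absorption merges finitely many orbits only. *)
Definition pending_in s (L : seq V) : Prop :=
  forall v,
    [\/ rep s v = v, inU (rep s v) | exists2 a, List.In a L & orbit a v].

Definition settled s : Prop := exists L, pending_in s L.

Lemma merge_rep s x y : good s -> stab x `<=` stab y ->
  exists r : V -> V,
    (forall v g, rep s v = act g x -> r v = act g y) /\
    (forall v, ~ orbit x (rep s v) -> r v = rep s v).
Proof.
move=> gs sxy.
have [|r rP] := @choice V V (fun v a =>
    (forall g, rep s v = act g x -> a = act g y) /\
    (~ orbit x (rep s v) -> a = rep s v)).
  move=> v; have [[g _ gE]|o] := pselect (orbit x (rep s v)); last first.
    exists (rep s v); split=> // g gE; case: o; rewrite gE; exact: orbit_act.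
  exists (act g y); split=> [k|[]]; last by exists g.
  by rewrite -gE => /eq_stab /sxy /stab_eq.
by exists r; split=> v; [case: (rP v)|case: (rP v)].
Qed.

(** Although [f] need not be incident to [x] in [now], only to a vertex merged
    into [x], merging its orbit amounts to moving the orbit of [x] to that of
    [y]: this makes sense since [stab x `<=` stab f `<=` stab y]. *)
Lemma merge_orbit s f x y : good s -> cends s f x y ->
  ~ inU x -> stab x `<=` stab f -> ~ orbit x y ->
  exists t, [/\ good t, evolves s t, merged t = merged s `|` orbit f,
    settled s -> settled t &
    now t = now s /\ (forall v g, rep s v = act g x -> rep t v = act g y) /\
    (forall v, ~ orbit x (rep s v) -> rep t v = rep s v)].
Proof.
move=> gs fxy nx sxf nxy.
have sxy : stab x `<=` stab y.
  by apply: subset_trans sxf _; apply: stab_cend gs (cendsC fxy).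
have [r [rx rn]] := merge_rep gs sxy.
have xx := cends_fix gs fxy; have yy := cends_fix gs (cendsC fxy).
have er : equivariant r.
  move=> g v; have [[k _ kE]|o] := pselect (orbit x (rep s v)).
    by rewrite (rx v k) // (rx _ (g * k)) ?actM // (rep_act gs) kE.
  rewrite rn; last by rewrite (rep_act gs) orbit_actE.
  by rewrite (rep_act gs) (rn v).
have ry g : r (act g y) = act g y.
  by rewrite rn (rep_act gs) yy // orbit_actE.
have rr v : r (rep s v) = r v.
  have [[k _ kE]|o] := pselect (orbit x (rep s v)).
    by rewrite (rx v k) // (rx _ k) // rep_idem.
  by rewrite !rn // (rep_idem gs).
have rU v : inU v -> r v = v.
  move=> uv; rewrite rn (rep_inU gs) //.
  by move=> [g _ gx]; apply: nx; rewrite -(inU_act g) gx.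
pose t := State (run s) (now s) (merged s `|` orbit f) r.
have mst : merged s `<=` merged t by move=> e; left.
have frst e : frozen s e -> frozen t e.
  by apply: frozenS; rewrite /t //; exact: same_refl.
have [p [q [pq px qy]]] := fxy.
have rpq : r p = r q.
  rewrite (rx p 1) ?act1 ?px // rn qy //.
have gt : good t.
  split=> //=.
  - exact: good_run gs.
  - move=> g e [/(merged_act gs g)|fe]; first by left.
    by right; apply/orbit_actE.
  - move=> v; have [[k _ kE]|o] := pselect (orbit x (rep s v)).
      by rewrite (rx v k).
    by rewrite (rn v o) rr rn.
  - move=> e [/(merged_rep gs)|[g _ <-]].
      by rewrite -rr => ->; rewrite rr.
    rewrite ini_equivariant ter_equivariant !er.
    by case: pq => -[-> ->]; rewrite rpq.
  - move=> v; have l := linkedS mst (rep_linked gs v).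
    have [[k _ kE]|o] := pselect (orbit x (rep s v)); last by rewrite rn.
    rewrite (rx v k) //; apply: linked_trans l _; rewrite -kE.
    have lp := linkedS mst (rep_linked gs (act k p)).
    have lq := linkedS mst (rep_linked gs (act k q)).
    move: lp lq; rewrite !(rep_act gs) px qy => lp lq.
    apply: linked_trans (linked_sym lp) _; apply: linked_trans lq.
    by apply: linked_end (ends_act k pq); right; exact: orbit_act.
  - move=> e P c; apply: (good_origin gs) => h hP; apply: c.
    by case: hP => [/frst|]; [left|right].
exists t; split=> //=.
- split=> //=; first exact: extends_refl.
  by move=> e; left; exact: same_refl.
move=> [L LP]; exists (x :: L) => v /=.
have [[k _ kE]|o] := pselect (orbit x (rep s v)).
  case: (LP v) => [vE|u|[a aL av]].
  - by apply: Or33; exists x; [left|rewrite -vE -kE; exact: orbit_act].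
  - by case: nx; rewrite -(inU_act k) kE.
  - by apply: Or33; exists a => //; right.
rewrite rn //; case: (LP v) => [?|?|[a aL av]]; [exact: Or31|exact: Or32|].
by apply: Or33; exists a => //; right.
Qed.

(** Sliding [e] is an evolution only once [e] gets merged, which comes later;
    meanwhile this relation is used. *)
Definition glides e s t : Prop :=
  [/\ extends (run s, now s) (run t, now t), merged t = merged s, rep t = rep s
    & forall h, ~ orbit e h -> same (now s) (now t) h].

Lemma glides_refl e s : glides e s s.
Proof. by split=> //; exact: extends_refl. Qed.

Lemma glides_trans e s t r : good s -> good t ->
  glides e s t -> glides e t r -> glides e s r.
Proof.
move=> gs gt [est mst rst sst] [etr mtr rtr str]; split.
- apply: (@extends_trans _ _ _ T0 _ (run t, now t)) => //; exact: good_run.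
- by rewrite mtr.
- by rewrite rtr.
by move=> h o; exact: same_trans (sst h o) (str h o).
Qed.

Lemma not_frozen s e x y : good s -> cends s e x y -> ~ inU x ->
  stab x `<=` stab e -> ~ orbit x y -> ~ frozen s e.
Proof.
move=> gs xy nx sx nxy [m|r]; apply: nxy; last exact: r.
rewrite (cends_merged gs m xy); exact: orbit_refl.
Qed.

(** The invariant [good_origin] survives because the old position of an edge
    is recovered from its new position and a frozen edge. *)
Lemma slide_frozen s e f p q z : good s -> ~ frozen s e -> frozen s f ->
  ends (now s) e p q -> ends (now s) f q z -> stab e `<=` stab f ->
  exists t, [/\ good t, glides e s t & ends (now t) e p z].
Proof.
move=> gs ne ff epq fqz sef.
have nh h : frozen s h -> ~ orbit e h.
  by move=> fh o; apply: ne; exact: frozen_orbit o fh.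
have [T' [sl epz oth]] := slide_exists epq fqz sef (nh f ff).
pose s' := Stage T' (fun h => moves (now s) h + `[< orbit e h >])%N.
have sameh h : ~ orbit e h -> same (now s) s' h.
  move=> o; have [i tE] := oth h o; split=> //=.
  by case: asboolP => // _; rewrite addn0.
have ear : earlier (now s) s'.
  move=> h; have [o|/sameh] := pselect (orbit e h); last by right.
  by left; rewrite /=; case: asboolP => // _; rewrite addn1.
have neq : now s <> s'.
  move=> eq; have := congr1 (fun a : stage V E => moves a e) eq.
  rewrite /=; case: asboolP => [_|[]]; last exact: orbit_refl.
  by rewrite addn1 => /eqP; rewrite eqn_leq ltnn andbF.
pose t := State (run s `|` [set s']) s' (merged s) (rep s).
have frst h : frozen s h -> frozen t h.
  move=> fh; apply: (frozenS (s := s)) (fh) => //=.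
  - exact: rep_act gs.
  - exact: rep_inU gs.
  - exact: rep_idem gs.
  - exact: sameh (nh _ fh).
have ext : extends (run s, now s) (run t, now t).
  split=> /= [a sa|a [sa|->]]; first by left.
    by left.
  by right.
exists t; split=> //.
split=> //=.
- by apply: (run_append (good_run gs) _ ear neq); exact: sl.
- exact: merged_act gs.
- exact: rep_act gs.
- exact: rep_idem gs.
- exact: rep_inU gs.
- move=> h mh; have [|-> -> _] := sameh h; last exact: merged_rep gs _ mh.
  by apply: nh; left.
- move=> v P c; apply: (rep_linked gs) => h mh.
  have [|i tE _] := sameh h; first by apply: nh; left.
  by have := c h mh; rewrite /= i tE.
move=> a P c.
have Pfr h : frozen s h -> P (ini (now s) h) <-> P (ter (now s) h).
  move=> fh; have [i tE _] := sameh h (nh h fh).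
  by have := c h (or_introl (frst h fh)); rewrite /= i tE.
apply: (good_origin gs) => h [fh|->]; first exact: Pfr.
have ca := c a (or_intror erefl).
have [[g _ ga]|o] := pselect (orbit e a); last first.
  by have [i tE _] := sameh a o; move: ca; rewrite /= i tE.
(* A translate of the slid edge is replaced by its new position followed by
   the translate, which is frozen, of the edge it was slid along. *)
have ffg : frozen s (act g f).
  by apply: frozen_orbit ff => //; apply: orbit_sym; exact: orbit_act.
have fP : P (act g q) <-> P (act g z).
  have c' : unsplit (now s) [set act g f] P by move=> _ ->; exact: Pfr.
  exact: unsplit_ends c' erefl (ends_act g fqz).
have eP : P (act g p) <-> P (act g z).
  have c' : unsplit s' [set a] P by move=> _ ->.
  by apply: unsplit_ends c' erefl _; rewrite -ga; exact: ends_act.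
have : ends (now s) a (act g p) (act g q) by rewrite -ga; exact: ends_act.
by case=> -[-> ->]; tauto.
Qed.

Lemma slide_merged s e p q z : good s -> ends (now s) e p q ->
  ~ inU (rep s p) -> stab (rep s p) `<=` stab e ->
  ~ orbit (rep s p) (rep s q) ->
  linked (now s) (merged s `&` [set f | stab e `<=` stab f]) q z ->
  exists t, [/\ good t, glides e s t & ends (now t) e p z].
Proof.
move=> gs epq nU sp np lqz.
pose P a := rep s a = rep s q /\
  exists t, [/\ good t, glides e s t & ends (now t) e p a].
have mv f a b : merged s f -> stab e `<=` stab f -> ends (now s) f a b ->
    P a -> P b.
  move=> mf sef fab [aq [t [gt st epa]]]; have [_ mE rE sE] := st.
  have ne : ~ frozen t e.
    apply: (@not_frozen t e (rep s p) (rep s q)) => //.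
    by exists p, a; split=> //; rewrite rE.
  have mf' : merged t f by rewrite mE.
  have nef : ~ orbit e f.
    by move=> o; apply: ne; left; apply: merged_orbit o mf'.
  have [i tE _] := sE f nef.
  have fab' : ends (now t) f a b by move: fab; rewrite /ends i tE.
  have [r [gr tr epb]] := slide_frozen gt ne (or_introl mf') epa fab' sef.
  split; last by exists r; split=> //; exact: glides_trans st tr.
  rewrite -aq; apply/esym; move: (merged_rep gs mf).
  by case: fab => -[-> ->].
suff [] : P z by [].
apply: lqz; last first.
  by split=> //; exists s; split=> //; exact: glides_refl.
move=> f [mf sef]; split; apply: mv mf sef _; [left|right] => //.
Qed.

(** In [now], the edges [e] and [f] need not be adjacent; their ends are linked
    by merged edges, and those on the geodesic have a stabilizer containing
    that of [e], by [linked_fixed].  So [e] is slid first along these, and then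
    along [f]. *)
Lemma slide_rigid s e f w y z : good s ->
  cends s e w y -> ~ inU w -> stab w `<=` stab e -> ~ orbit w y ->
  cends s f y z -> rigid s f -> stab e `<=` stab f ->
  exists t, [/\ good t, glides e s t & cends t e w z].
Proof.
move=> gs ewy nw sw nwy fyz rf sef.
have nef : ~ orbit e f.
  move=> o; apply: (not_frozen gs ewy nw sw nwy).
  by right; exact: rigid_orbit o rf.
have [p [q [epq pw qy]]] := ewy; have [a [b [fab ay bz]]] := fyz.
subst w y.
have lqa : linked (now s) (merged s) q a.
  apply: linked_trans (rep_linked gs q) _; rewrite -ay.
  exact: linked_sym (rep_linked gs a).
have {}lqa := linked_fixed (gtree_is_tree (now s)) (stab_end (endsC epq))
  (subset_trans sef (stab_end fab)) lqa.
have [t [gt st epa]] := slide_merged gs epq nw sw nwy lqa.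
have [_ mE rE sE] := st.
have sf := sE f nef; have [i tE _] := sf.
have ff : frozen t f.
  apply: (frozen_good gs gt) sf (or_intror rf); first by rewrite mE.
  by rewrite rE; exact: rep_idem gs.
have fab' : ends (now t) f a b by move: fab; rewrite /ends i tE.
have ne : ~ frozen t e.
  apply: (@not_frozen t e (rep s p) (rep s q)) => //.
  by exists p, a; rewrite rE.
have [r [gr tr epb]] := slide_frozen gt ne ff epa fab' sef.
exists r; split=> //; first exact: glides_trans st tr.
by have [_ _ rE' _] := tr; exists p, b; split=> //; rewrite rE' rE.
Qed.

(** Avoiding the orbit of [w], unlike being shortest, is preserved when edges
    are merged or slid.  Steps along merged edges are harmless: in the
    compressed tree, they go from a vertex to itself. *)
Fixpoint apath s (H : set G) w n x : Prop :=
  ~ orbit w x /\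
  if n is n'.+1 then
    exists f y, [/\ cends s f x y, H `<=` stab f & apath s H w n' y]
  else inU x.

Lemma apath_notin s H w n x : apath s H w n x -> ~ orbit w x.
Proof. by case: n => [|n] []. Qed.

Lemma apath_evolves s t H w n v : good s -> evolves s t -> good t ->
  now t = now s ->
  (forall a, ~ orbit w (rep s a) -> ~ orbit w (rep t a)) ->
  apath s H w n (rep s v) -> apath t H w n (rep t v).
Proof.
move=> gs [_ _ rst _] gt nE avoid; elim: n v => [|n IH] v /= [nw].
  by move=> u; split; [exact: avoid|rewrite -rst (rep_inU gt u)].
move=> [f [y [[p [q [fpq pv qy]]] Hf yP]]]; split; first exact: avoid.
exists f, (rep t q); split=> //; last by apply: IH; rewrite qy.
by exists p, q; rewrite nE; split=> //; rewrite -rst pv rst.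
Qed.

Lemma apath_glides s t e H w y n x : good s -> cends s e w y -> glides e s t ->
  apath s H w n x -> apath t H w n x.
Proof.
move=> gs ewy [_ _ rE sE]; elim: n x => [|n IH] x //= [nx].
move=> [f [z [fxz Hf zP]]]; split=> //; exists f, z; split=> //; last exact: IH.
have nz := apath_notin zP.
have [|i tE _] := sE f.
  move=> [g _ gf]; have := cends_act g gs ewy; rewrite gf => /(cends_uniq fxz).
  by case=> -[gw _]; [apply: nx|apply: nz]; rewrite -gw; exact: orbit_act.
by case: fxz => p [q [pq <- <-]]; exists p, q; rewrite /ends i tE rE.
Qed.

(** If [f] is the first edge of the path from [y], merging [f] or sliding [e]
    along it brings [e] one step closer to [U].  The orbit of [w] is avoided, so
    that [w] itself is not merged too early and that the rest of the path does
    not use translates of [e]. *)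
Lemma absorb n s e w y : good s ->
  cends s e w y -> ~ inU w -> stab w `<=` stab e -> apath s (stab w) w n y ->
  exists t, [/\ good t, evolves s t, merged t e, inU (rep t w)
    & settled s -> settled t].
Proof.
elim: n s y => [|n IH] s y gs ewy nw sw.
  move=> [nwy uy].
  have [t [gt st mt se [_ [rx _]]]] := merge_orbit gs ewy nw sw nwy.
  exists t; split=> //; first by rewrite mt; right; exact: orbit_refl.
  by rewrite (rx w 1) ?act1 //; exact: cends_fix gs ewy.
move=> [nwy [f [z [fyz swf zP]]]].
have nwz := apath_notin zP.
have nef : ~ orbit f e.
  move=> [g _ ge]; have := cends_act g gs fyz; rewrite ge => /(cends_uniq ewy).
  case=> [[gy _]|[_ gz]]; [apply: nwy|apply: nwz]; apply: orbit_sym.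
    by exists g.
  by exists g.
have [mf|nmf] := pselect (merged s f).
  by apply: IH ewy nw sw _ => //; rewrite (cends_merged gs mf fyz).
have [rf|nrf] := pselect (rigid s f).
  have sef : stab e `<=` stab f.
    by apply: subset_trans swf; exact: stab_cend ewy.
  have [t [gt st ewz]] := slide_rigid gs ewy nw sw nwy fyz rf sef.
  have [r [gr tr mr ur se]] := IH t z gt ewz nw sw (apath_glides gs ewy st zP).
  have [est mE rE sE] := st; have [etr mtr rtr str] := tr.
  exists r; split=> //; last first.
    by case=> L LP; apply: se; exists L => v; rewrite rE.
  split.
  - apply: (@extends_trans _ _ _ T0 _ (run t, now t)) => //; exact: good_run.
  - by rewrite -mE.
  - by rewrite -rE.
  move=> h; have [o|o] := pselect (orbit e h).
    right; split.
      move=> fh; apply: (not_frozen gs ewy nw sw nwy); exact: frozen_orbit o fh.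
    by have [g _ <-] := o; exact: merged_act gr _ _ mr.
  case: (str h) => [m|[nf m]]; first by left; exact: same_trans (sE h o) m.
  right; split=> // fh; apply: nf; apply: frozen_good (sE h o) fh => //.
    by rewrite mE.
  by rewrite rE; exact: rep_idem gs.
have [x1 [y1 [f1 nU1 s1 n1]]] : exists x1 y1,
    [/\ cends s f x1 y1, ~ inU x1, stab x1 `<=` stab f & ~ orbit x1 y1].
  apply: contrapT => no; apply: nrf => a b fab na sa; apply: contrapT => nab.
  by apply: no; exists a, b.
have [nw1 nw2] : ~ orbit w x1 /\ ~ orbit w y1.
  by case: (cends_uniq fyz f1) => -[-> ->].
have [t [gt st mt se [nE [rx rn]]]] := merge_orbit gs f1 nU1 s1 n1.
have rst v : rep t (rep s v) = rep t v by case: st.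
have ww := cends_fix gs ewy.
have rw : rep t w = w by rewrite rn ww // => /orbit_sym.
have ryz : rep t y = rep t z.
  have [p [q [pq <- <-]]] := fyz; rewrite !rst.
  have mf : merged t f by rewrite mt; right; exact: orbit_refl.
  by have := merged_rep gt mf; rewrite nE; case: pq => -[-> ->].
have ewz : cends t e w (rep t z).
  have [p [q [pq pw qy]]] := ewy; exists p, q; rewrite nE; split=> //.
    by rewrite -rst pw rw.
  by rewrite -rst qy ryz.
have zP' : apath t (stab w) w n (rep t z).
  apply: (apath_evolves (s := s)) => //; last first.
    by rewrite (cends_fix gs (cendsC fyz)).
  move=> a na; have [[g _ gE]|o] := pselect (orbit x1 (rep s a)).
    by rewrite (rx a g) // orbit_actE.
  by rewrite rn.
have [r [gr tr mr ur se']] := IH t _ gt ewz nw sw zP'.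
exists r; split=> //; first exact: evolves_trans st tr.
by move=> /se /se'.
Qed.

Fixpoint rpath s (H : set G) n x : Prop :=
  if n is n'.+1 then
    exists f y, [/\ cends s f x y, H `<=` stab f & rpath s H n' y]
  else inU x.

Lemma rpath_act s (H K : set G) n x g : good s ->
  (forall k, K k -> H (g^-1 * (k * g))) ->
  rpath s H n x -> rpath s K n (act g x).
Proof.
move=> gs KH; elim: n x => [|n IH] x /=; first by rewrite inU_act.
move=> [f [y [fxy Hf yP]]]; exists (act g f), (act g y); split.
- exact: cends_act.
- by move=> k /KH /Hf ?; apply/stab_act.
exact: IH.
Qed.

(** If a shortest path came back to [act g w], both [w] and [act g w] would have
    the same stabilizer by incomparability, and translating the remainder of
    the path by [g^-1] would give a shorter path from [w]. *)
Lemma rpath_apath s w n y : good s -> conj_incomparable (stab w) ->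
  (forall m, (m <= n)%N -> ~ rpath s (stab w) m w) ->
  stab w `<=` stab y ->
  rpath s (stab w) n y -> apath s (stab w) w n y.
Proof.
move=> gs ci; have back k a : stab w `<=` stab a -> orbit w a ->
    rpath s (stab w) k a -> rpath s (stab w) k w.
  move=> + [g _ ga]; rewrite -ga => swa aP; rewrite -{2}(actK g w).
  apply: rpath_act aP => // h hw.
  have /seteqP [sw _] := incomparable_stab_act ci swa.
  by apply: sw; apply/stab_act; rewrite invgK -!mulgA mulVg mulg1 mulKg.
elim: n y => [|n IH] y short swy yP; have nwy : ~ orbit w y.
1,3: by move=> o; apply: (short _ (leqnn _)); exact: back o yP.
  by split.
move: yP => /= [f [z [fyz swf zP]]]; split=> //; exists f, z; split=> //.
apply: IH => //; first by move=> m /leqW; exact: short.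
exact: subset_trans swf (stab_cend gs (cendsC fyz)).
Qed.

Lemma absorb_vertex s w : gretract U -> good s -> rep s w = w -> ~ inU w ->
  conj_incomparable (stab w) ->
  exists t, [/\ good t, evolves s t, inU (rep t w) & settled s -> settled t].
Proof.
move=> ret gs ww nw ci; have [u uU swu] := ret w nw.
pose F : set E := setT `&` [set e | stab w `<=` stab e].
have l : linked (now s) F u w.
  apply: linked_sym; apply: linked_fixed => //.
    exact: gtree_is_tree.
  exact: tree_linked (gtree_is_tree _).
have [n nP] : exists n, rpath s (stab w) n w.
  rewrite -{2}ww; pose P v := exists n, rpath s (stab w) n (rep s v).
  apply: (l P); last by exists 0%N; rewrite /= (rep_inU gs).
  move=> e [_ se]; split=> -[n nP]; exists n.+1.
    exists e, (rep s (ini (now s) e)); split=> //.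
    by apply: cendsC; exists (ini (now s) e), (ter (now s) e); split=> //; left.
  exists e, (rep s (ter (now s) e)); split=> //.
  by exists (ini (now s) e), (ter (now s) e); split=> //; left.
have exn : exists n, `[< rpath s (stab w) n w >] by exists n; apply/asboolP.
case: (ex_minnP exn) => {n nP} -[|n] /asboolP nP min; first by case: nw.
move: nP => /= [e [y [ewy swe yP]]].
have ap : apath s (stab w) w n y.
  apply: rpath_apath => //; last first.
    exact: subset_trans swe (stab_cend gs (cendsC ewy)).
  by move=> m mn /asboolP /min; rewrite ltnNge mn.
have [t [gt st _ ut se]] := absorb gs ewy nw swe ap.
by exists t.
Qed.

End States.

(** * Limits of chains of states *)

Section Limits.
Variables (G : groupType) (V E : gset G) (T0 : gtree V E) (U : gsubset V).

Notation inU := (gsubset_set U).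
Notation state := (state V E).
Notation good := (good T0 U).
Notation evolves := (evolves U).

Implicit Types (s t : state) (e f h : E) (v w x y z : V).

Lemma evolves_inU s t v : good t -> evolves s t -> inU (rep s v) ->
  rep t v = rep s v.
Proof. by move=> gt [_ _ rst _] u; rewrite -rst (rep_inU gt). Qed.

Lemma evolves_earlier s t : good s -> good t -> evolves s t ->
  earlier (now s) (now t).
Proof.
move=> gs gt [est _ _ _].
apply: (@extends_earlier _ _ _ T0 (run s, now s) (run t, now t)) => //.
  exact: good_run gs.
exact: good_run gt.
Qed.

Section Chain.
Variable C : set state.
Hypothesis C_ne : C !=set0.
Hypothesis C_good : forall s, C s -> good s.
Hypothesis C_total : forall s t, C s -> C t -> evolves s t \/ evolves t s.
Hypothesis C_settles : forall s v, C s ->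
  rep s v = v \/ exists2 t, C t & evolves s t /\ inU (rep t v).

Definition eventually (Q : state -> Prop) : Prop :=
  exists2 s, C s & forall t, C t -> evolves s t -> Q t.

Lemma eventually_and Q Q' :
  eventually Q -> eventually Q' -> eventually (fun t => Q t /\ Q' t).
Proof.
move=> [s Cs sQ] [s' Cs' sQ']; case: (C_total Cs Cs') => ss'.
  exists s' => // t Ct st; split; last exact: sQ'.
  by apply: sQ => //; apply: evolves_trans ss' st; exact: C_good.
exists s => // t Ct st; split; first exact: sQ.
by apply: sQ' => //; apply: evolves_trans ss' st; exact: C_good.
Qed.

Lemma eventually_ex Q : eventually Q -> exists2 t, C t & Q t.
Proof.
move=> [s Cs sQ]; exists s => //; apply: sQ => //.
exact: evolves_refl (C_good Cs).
Qed.

Lemma eventually_evolves s : C s -> eventually (evolves s).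
Proof. by exists s. Qed.

Lemma eventuallyT (Q : state -> Prop) : (forall t, C t -> Q t) -> eventually Q.
Proof. by case: C_ne => s Cs CQ; exists s => // t /CQ. Qed.

(** An edge moves only on its way to being merged, after which it never
    moves again. *)
Lemma edge_settles e : exists s,
  C s /\ forall t, C t -> evolves s t -> same (now s) (now t) e.
Proof.
have [[s Cs ms]|nm] := pselect (exists2 s, C s & merged s e).
  by exists s; split=> // t Ct st; apply: (frozen_same st); left.
have [s Cs] := C_ne; exists s; split=> // t Ct [_ _ _ /(_ e) [//|[_ mt]]].
by case: nm; exists t.
Qed.

Let sel e : state := sval (cid (edge_settles e)).

Let selC e : C (sel e). Proof. by case: (svalP (cid (edge_settles e))). Qed.

Let sel_same e t : C t -> evolves (sel e) t -> same (now (sel e)) (now t) e.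
Proof. by case: (svalP (cid (edge_settles e))) => _; apply. Qed.

Let limit_ini e := ini (now (sel e)) e.
Let limit_ter e := ter (now (sel e)) e.

Let limit_val e : eventually (fun t =>
  limit_ini e = ini (now t) e /\ limit_ter e = ter (now t) e).
Proof.
by exists (sel e); [exact: selC|move=> t Ct /(sel_same Ct) [-> -> _]].
Qed.

Let limit_ini_equivariant : equivariant limit_ini.
Proof.
move=> g e.
have [t Ct [[-> _] [-> _]]] :=
  eventually_ex (eventually_and (limit_val (act g e)) (limit_val e)).
exact: ini_equivariant.
Qed.

Let limit_ter_equivariant : equivariant limit_ter.
Proof.
move=> g e.
have [t Ct [[_ ->] [_ ->]]] :=
  eventually_ex (eventually_and (limit_val (act g e)) (limit_val e)).
exact: ter_equivariant.
Qed.

Let limit_graph := GGraph limit_ini_equivariant limit_ter_equivariant.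

(** If the ends of an edge are linked without it in the limit, finitely many
    edges link them, so they are linked without it at some stage; with unsplit
    sets, this compactness argument becomes the fact that the vertices
    eventually linked to an end form an unsplit set. *)
Lemma limit_is_tree : is_tree limit_graph.
Proof.
have /is_treeP [v0 conn _] := gtree_is_tree T0.
apply/is_treeP; split=> // [v w P c|a l].
  apply: (conn v w P) => e _.
  have [s Cs [ie te]] := eventually_ex (limit_val e).
  apply: (good_origin (C_good Cs)) => h [fh|->]; last first.
    by have := c e I; rewrite /= ie te.
  have := c h I; rewrite /=.
  have [t Ct [[-> ->] st]] :=
    eventually_ex (eventually_and (limit_val h) (eventually_evolves Cs)).
  by have [-> -> _] := frozen_same st fh.
pose P v := eventually (fun t =>
  linked (now t) ([set: E] `\ a) (limit_ini a) v).
have : P (limit_ter a).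
  apply: l; last by apply: eventuallyT => t _; exact: linked_refl.
  move=> h hF /=; have val := limit_val h.
  split=> Ph; have [s Cs sP] := eventually_and val Ph; exists s => // t Ct st.
    have [[-> ->] lt] := sP t Ct st; apply: linked_trans lt _.
    by apply: linked_end hF (ends_ini _ _).
  have [[-> ->] lt] := sP t Ct st; apply: linked_trans lt _.
  by apply: linked_end hF (endsC (ends_ini _ _)).
move=> Pa.
have [t Ct [[-> ->]]] := eventually_ex (eventually_and (limit_val a) Pa).
by have /is_treeP [_ _] := gtree_is_tree (now t); apply.
Qed.

Let limit_stage := Stage (GTree limit_is_tree) (fun e => moves (now (sel e)) e).

Let limit_same e : eventually (fun t => same (now t) limit_stage e).
Proof.
by exists (sel e); [exact: selC|move=> t Ct /(sel_same Ct) /same_sym].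
Qed.

(** Once [rep t v] is in [U], it no longer changes. *)
Lemma rep_settles v : exists x, eventually (fun t => rep t v = x).
Proof.
have [[s Cs ns]|nm] := pselect (exists2 s, C s & rep s v <> v).
  have [//|[t Ct [_ ut]]] := C_settles v Cs.
  exists (rep t v); exists t => // r Cr tr.
  by apply: evolves_inU ut => //; exact: C_good.
exists v; apply: eventuallyT => t Ct.
by apply: contrapT => nt; apply: nm; exists t.
Qed.

Let limit_rep v := sval (cid (rep_settles v)).

Let limit_repP v : eventually (fun t => rep t v = limit_rep v).
Proof. exact: (svalP (cid (rep_settles v))). Qed.

Let limit_merged : set E := [set e | exists2 s, C s & merged s e].

Let CR : set (set (stage V E) * stage V E) := [set (run s, now s) | s in C].

Let limit := State ((\bigcup_(p in CR) p.1) `|` [set limit_stage])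
  limit_stage limit_merged limit_rep.

Lemma limit_earlier s : C s -> earlier (now s) limit_stage.
Proof.
move=> Cs e; have [t Ct [m st]] :=
  eventually_ex (eventually_and (limit_same e) (eventually_evolves Cs)).
case: (evolves_earlier (C_good Cs) (C_good Ct) st e) => [l|m'].
  by left; case: m => _ _ ->.
by right; exact: same_trans m' m.
Qed.

Lemma CR_run p : CR p -> is_run T0 p.1 p.2.
Proof. by move=> [s Cs <-]; exact: good_run (C_good Cs). Qed.

Lemma CR_total p q : CR p -> CR q -> extends p q \/ extends q p.
Proof.
move=> [s Cs <-] [t Ct <-].
by case: (C_total Cs Ct) => -[? _ _ _]; [left|right].
Qed.

Lemma limit_inU v : inU v -> limit_rep v = v.
Proof.
move=> u; have [t Ct <-] := eventually_ex (limit_repP v).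
exact: rep_inU (C_good Ct) _ u.
Qed.

Lemma limit_rep_act : equivariant limit_rep.
Proof.
move=> g v; have [t Ct [<- <-]] :=
  eventually_ex (eventually_and (limit_repP (act g v)) (limit_repP v)).
exact: rep_act (C_good Ct) _ _.
Qed.

Lemma limit_rep_rep s v : C s -> limit_rep (rep s v) = limit_rep v.
Proof.
move=> Cs; have [t Ct [<- [<- [_ _ -> _]]]] :=
  eventually_ex (eventually_and (limit_repP (rep s v))
    (eventually_and (limit_repP v) (eventually_evolves Cs))).
by [].
Qed.

Lemma limit_frozen_same s e : C s -> frozen U s e -> same (now s) limit_stage e.
Proof.
move=> Cs fe; have [t Ct [m st]] :=
  eventually_ex (eventually_and (limit_same e) (eventually_evolves Cs)).
exact: same_trans (frozen_same st fe) m.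
Qed.

Lemma limit_frozen s e : C s -> frozen U s e -> frozen U limit e.
Proof.
move=> Cs fe; apply: (frozenS (C_good Cs)) (fe).
- exact: limit_rep_act.
- exact: limit_inU.
- by move=> h mh; exists s.
- by move=> v; exact: limit_rep_rep.
- exact: limit_frozen_same.
Qed.

Lemma limit_good : good limit.
Proof.
split=> /=.
- apply: run_union.
  + by case: C_ne => s Cs; exists (run s, now s), s.
  + exact: CR_run.
  + exact: CR_total.
  + by move=> _ [s Cs <-]; exact: limit_earlier.
  + move=> e; have [t Ct m] := eventually_ex (limit_same e).
    by exists (run t, now t) => //; exists t.
- by move=> g e [s Cs m]; exists s => //; exact: merged_act (C_good Cs) _ _ m.
- exact: limit_rep_act.
- move=> v; have [t Ct [<- <-]] :=
    eventually_ex (eventually_and (limit_repP (limit_rep v)) (limit_repP v)).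
  exact: rep_idem (C_good Ct) _.
- exact: limit_inU.
- move=> e [s Cs m]; have fe : frozen U s e by left.
  have [i tE _] := limit_frozen_same Cs fe.
  rewrite -[LHS]/(limit_rep (ini limit_stage e)) i.
  rewrite -[RHS]/(limit_rep (ter limit_stage e)) tE.
  by rewrite -(limit_rep_rep _ Cs) (merged_rep (C_good Cs) m) limit_rep_rep.
- move=> v P c; have [t Ct <-] := eventually_ex (limit_repP v).
  apply: (rep_linked (C_good Ct)) => e m; have fe : frozen U t e by left.
  have [i tE _] := limit_frozen_same Ct fe.
  have : limit_merged e by exists t.
  by move=> /c /=; rewrite -i -tE.
move=> a P c; have [t Ct ma] := eventually_ex (limit_same a).
apply: (good_origin (C_good Ct)) => h hF.
have [i tE _] : same (now t) limit_stage h.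
  by case: hF => [fh|->//]; exact: limit_frozen_same.
rewrite -i -tE; apply: c.
by case: hF => [fh|->]; [left; exact: limit_frozen fh|right].
Qed.

Lemma chain_limit : exists t, [/\ good t, pending_in U t [::] &
  forall s, C s -> evolves s t].
Proof.
exists limit; split; first exact: limit_good.
  move=> v; have [s Cs sP] := limit_repP v.
  have [sv|[t Ct [st ut]]] := C_settles v Cs.
    by apply: Or31; rewrite /= -(sP s Cs) // ; apply: evolves_refl (C_good Cs).
  by apply: Or32; rewrite /= -(sP t Ct).
move=> s Cs; split=> /=.
- apply: extends_union; [exact: CR_run|exact: CR_total|exact: limit_earlier|].
  by exists s.
- by move=> e m; exists s.
- by move=> v; exact: limit_rep_rep.
move=> e; have [t Ct [m [_ _ _ /(_ e) st]]] :=
  eventually_ex (eventually_and (limit_same e) (eventually_evolves Cs)).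
case: st => [m'|[nf mt]]; first by left; exact: same_trans m' m.
by right; split=> //; exists t.
Qed.

End Chain.

Hypothesis U_retract : gretract U.
Hypothesis incomparable : forall w, ~ inU w -> conj_incomparable (stab w).

Lemma absorb_list s (L : seq V) : good s ->
  exists t, [/\ good t, evolves s t, forall a, List.In a L -> inU (rep t a)
    & settled U s -> settled U t].
Proof.
move=> gs; elim: L => [|a L [t [gt st tL tset]]].
  by exists s; split=> //; exact: evolves_refl gs.
have [ua|na] := pselect (inU (rep t a)).
  by exists t; split=> // b [<-//|]; exact: tL.
have [r [gr tr ur rset]] :=
  absorb_vertex U_retract gt (rep_idem gt a) na (incomparable na).
exists r; split=> //; [exact: evolves_trans gs gt gr st tr| |by move/tset/rset].
have [_ _ rtr _] := tr.
move=> b [<-|/tL ub]; first by rewrite -rtr.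
by rewrite (evolves_inU gr tr ub).
Qed.

Lemma settle s : good s -> settled U s ->
  exists t, [/\ good t, settled U t, evolves s t &
    forall v, rep s v = v \/ inU (rep t v)].
Proof.
move=> gs [L LP]; have [t [gt st tL tset]] := absorb_list L gs.
exists t; split=> //; first by apply: tset; exists L.
move=> v; case: (LP v) => [|u|[a aL [g _ <-]]]; [by left|right|right].
  by rewrite (evolves_inU gt st u).
by rewrite (rep_act gt) inU_act; exact: tL.
Qed.

(** [settle] absorbs the finitely many orbits pending in a state, but may
    create new pending ones; these disappear in the limit of a sequence of such
    steps. *)
Lemma settle_all s : good s -> settled U s ->
  exists t, [/\ good t, pending_in U t [::] & evolves s t].
Proof.
move=> gs ss; pose X := {t : state | good t /\ settled U t}.
have [|next nextP] := @choice X X (fun x y : X => evolves (sval x) (sval y) /\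
    forall v, rep (sval x) v = v \/ inU (rep (sval y) v)).
  move=> [t [gt st]]; have [r [gr sr tr rP]] := settle gt st.
  by exists (exist _ r (conj gr sr)).
pose x0 : X := exist _ s (conj gs ss); pose x n := iter n next x0.
have xg n : good (sval (x n)) by case: (svalP (x n)).
have xle m n : evolves (sval (x m)) (sval (x (m + n)%N)).
  elim: n => [|n IH]; first by rewrite addn0; exact: evolves_refl.
  rewrite addnS.
  exact: evolves_trans (xg m) (xg _) (xg _.+1) IH (proj1 (nextP (x (m + n)%N))).
have [||||t [gt pt tP]] := @chain_limit [set sval (x n) | n in setT].
- by exists (sval (x 0%N)), 0%N.
- by move=> _ [n _ <-].
- move=> _ _ [m _ <-] [n _ <-]; case: (leqP m n) => [mn|/ltnW nm].
    by left; rewrite -(subnKC mn).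
  by right; rewrite -(subnKC nm).
- move=> _ v [n _ <-]; have [nn /(_ v) [|u]] := nextP (x n); [by left|right].
  by exists (sval (x n.+1)) => //; exists n.+1.
by exists t; split=> //; apply: tP; exists 0%N.
Qed.

Lemma initial_good : good (State [set start T0] (start T0) set0 id).
Proof.
split=> //=; first exact: run_initial.
  exact: linked_refl.
by move=> e P c; exact: (c e (or_intror erefl)).
Qed.

Theorem fully_absorbed : exists2 s, good s & forall v, inU (rep s v).
Proof.
pose X := {s : state | good s /\ pending_in U s [::]}.
pose R : rel X := fun s t : X => `[< evolves (sval s) (sval t) >].
have g0 := initial_good.
have p0 : pending_in U (State [set start T0] (start T0) set0 id) [::].
  by move=> v; apply: Or31.
pose x0 : X := exist _ (State [set start T0] (start T0) set0 id) (conj g0 p0).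
have [|||m mP] := @ZL_preorder X x0 R.
- by move=> [s [gs ps]]; apply/asboolP; exact: evolves_refl gs.
- move=> [s [gs ps]] [t [gt pt]] [r [gr pr]] /asboolP /= st /asboolP /= tr.
  by apply/asboolP; exact: evolves_trans gs gt gr st tr.
- move=> A Atot; have [[a Aa]|nA] := pselect (A !=set0); last first.
    by exists x0 => s As; case: nA; exists s.
  have [||||t [gt pt tP]] := @chain_limit [set sval s | s in A].
  + by exists (sval a), a.
  + by move=> _ [[s [gs ps]] _ <-].
  + move=> _ _ [s As <-] [t At <-].
    by case: (Atot s t As At) => /asboolP; [left|right].
  + move=> _ v [[s [gs ps]] As <-] /=.
    case: (ps v) => [|u|[? []]]; [by left|right].
    exists s; last by split=> //; exact: evolves_refl gs.
    by exists (exist _ s (conj gs ps)).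
  pose y : X := exist _ t (conj gt pt); exists y => s As; apply/asboolP => /=.
  by apply: tP; exists s.
case: m mP => s [gs ps] mP; exists s => // v.
case: (ps v) => [sv|//|[? []]]; apply: contrapT => nv.
rewrite sv in nv.
have [t [gt st ut tset]] := absorb_vertex U_retract gs sv nv (incomparable nv).
have [|r [gr pr tr]] := settle_all gt (tset _); first by exists [::].
have sr := evolves_trans gs gt gr st tr.
pose y : X := exist _ r (conj gr pr); pose x : X := exist _ s (conj gs ps).
have /asboolP [_ _ /(_ v) /= rsE _] : R y x by apply: mP; exact/asboolP.
move: nv; rewrite -{1}sv -rsE (evolves_inU gr tr ut) (rep_inU gs ut).
exact.
Qed.

End Limits.

(** * Compressing the merged edges *)

Section Compression.
Variables (G : groupType) (V E : gset G) (T : ggraph V E) (T_tree : is_tree T).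
Variables (U : gsubset V) (K : gsubset E) (r : V -> V).

Notation inU := (gsubset_set U).
Notation inK := (gsubset_set K).

Hypothesis r_act : equivariant r.
Hypothesis r_inU : forall v, inU (r v).
Hypothesis r_fix : forall v, inU v -> r v = v.
Hypothesis r_edge : forall e, inK e -> r (ini T e) = r (ter T e).
Hypothesis r_linked : forall v, linked T inK v (r v).

Implicit Types (e h : E) (v w x : V).

Lemma ends_unlinked F e x y : ends T e x y -> ~ linked T (F `\ e) x y.
Proof.
move=> exy l; have [P [c Px nPy]] := tree_cut T_tree exy.
by apply: nPy; apply: l Px => h [_ he]; exact: c.
Qed.

Lemma linked_r v w : linked T inK v w -> r v = r w.
Proof.
move=> l; have c : unsplit T inK [set x | r v = r x].
  by move=> e /r_edge /= ->.
exact: (l _ c).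
Qed.

(** A link that uses [e] can be started at the end of [e] it leaves last. *)
Lemma inK_side e x y z : inK e -> ends T e x y -> linked T inK x z ->
  linked T (inK `\ e) x z \/ linked T (inK `\ e) y z.
Proof.
move=> Ke exy l.
pose P a := linked T (inK `\ e) x a \/ linked T (inK `\ e) y a.
suff c : unsplit T inK P by apply: (l P c); left; exact: linked_refl.
move=> h Kh; have [->|he] := pselect (h = e).
  have xP : P x by left; exact: linked_refl.
  have yP : P y by right; exact: linked_refl.
  by case: exy => -[-> ->].
have hh := @unsplit_linked _ _ _ T (inK `\ e) _ h (conj Kh he).
by rewrite /P (hh x) (hh y).
Qed.

Lemma first_edge v : ~ inU v ->
  exists e x, [/\ inK e, ends T e v x & linked T (inK `\ e) x (r v)].
Proof.
move=> nv; pose P a := a = v \/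
  exists e x, [/\ inK e, ends T e v x & linked T (inK `\ e) x a].
suff c : unsplit T inK P.
  have [rv|//] : P (r v) by apply: (r_linked c); left.
  by case: nv; rewrite -rv.
have mv h a b : inK h -> ends T h a b -> P a -> P b.
  move=> Kh hab [av|[e [x [Ke evx l]]]].
    by right; exists h, b; rewrite -av; split=> //; exact: linked_refl.
  have [he|he] := pselect (h = e); last first.
    right; exists e, x; split=> //; apply: linked_trans l _.
    exact: linked_end hab.
  rewrite he in hab; case: (ends_uniq evx hab) => -[_ ->]; last by left.
  by right; exists e, x; split=> //; exact: linked_refl.
by move=> h Kh; split; apply: mv Kh _; [left|right].
Qed.

(** The edges whose initial vertex is the end closer to the vertex of [U] in
    their component; they have to be reoriented. *)
Definition against : set E :=
  [set e | inK e /\ linked T (inK `\ e) (ini T e) (r (ini T e))].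

Lemma against_act g e : against e -> against (act g e).
Proof.
move=> [Ke l]; split; first exact: gsubset_act.
rewrite ini_equivariant r_act => P c; pose Q := [set v | P (act g v)].
apply: (l Q) => h [Kh he]; rewrite /Q /= -ini_equivariant -ter_equivariant.
by apply: c; split; [exact: gsubset_act|move/act_inj].
Qed.

Let T1 := flip (GSubset against_act) T.

Lemma ends_T1 e : ends T e (ini T1 e) (ter T1 e).
Proof. by apply/(ends_flip (GSubset against_act)); left. Qed.

Lemma ter_side e : inK e -> linked T (inK `\ e) (ter T1 e) (r (ini T1 e)).
Proof.
move=> Ke; have [d nd] := flipE (GSubset against_act) T e.
have [ag|ag] := pselect (against e).
  by have [-> ->] := d ag; rewrite -r_edge //; case: ag.
have [-> ->] := nd ag.
have [l|//] := inK_side Ke (ends_ini T e) (r_linked (v := ini T e)).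
by case: ag.
Qed.

Lemma r_T1 e : inK e -> r (ini T1 e) = r (ter T1 e).
Proof. by move/r_edge; case: (ends_T1 e) => -[-> ->]. Qed.

Lemma ini_exists v : ~ inU v -> exists2 e, inK e & ini T1 e = v.
Proof.
move=> nv; have [e [x [Ke evx l]]] := first_edge nv; exists e => //.
have [[//]|[xE vE]] := ends_uniq evx (ends_T1 e).
have := ter_side Ke; rewrite xE vE.
have -> : r x = r v by apply: esym; apply: linked_r; exact: linked_end evx.
by move=> l'; case: (ends_unlinked evx (linked_trans l' (linked_sym l))).
Qed.

Lemma ini_inj e h : inK e -> inK h -> ini T1 e = ini T1 h -> e = h.
Proof.
move=> Ke Kh eh; have ee := ends_T1 e; rewrite eh in ee.
have sub a : inK `\ a `<=` [set: E] `\ a by move=> b [].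
apply: (first_edge_unique (z := r (ini T1 e)) T_tree ee _ (ends_T1 h)).
  exact: linkedS (sub e) (ter_side Ke).
by rewrite eh; apply: linkedS (sub h) (ter_side Kh).
Qed.

Lemma ini_notin e : inK e -> ~ inU (ini T1 e).
Proof.
move=> Ke u; have := ter_side Ke; rewrite (r_fix u).
exact: ends_unlinked (endsC (ends_T1 e)).
Qed.

Lemma sinkE v : sink T1 inK v <-> inU v.
Proof.
split=> [s|u e Ke /joinedP /linked_flip /linked_r].
  apply: contrapT => /ini_exists [e Ke ev].
  have /joinedP /linked_flip l : joined T1 (inK `\ e) (ter T1 e) v.
    by apply: s => //; rewrite ev; exists [::].
  apply: (ends_unlinked (F := inK) (ends_T1 e)).
  by rewrite ev; exact: linked_sym l.
rewrite (r_fix u) => rv; apply/joinedP/linked_flip; rewrite -rv.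
exact: ter_side.
Qed.

Lemma sink_ofE v : sink_of T1 inK v (r v).
Proof.
by split; [apply/joinedP/linked_flip|apply/sinkE].
Qed.

Notation E' := (gsubsetC K).

Definition collapse (v : V) : sub_gset U := exist _ (r v) (mem_set (r_inU v)).

Lemma collapse_act : equivariant (collapse : V -> sub_gset U).
Proof. by move=> g v; apply: val_inj; rewrite /= r_act. Qed.

Definition compressed : ggraph (sub_gset U) (sub_gset E').
Proof.
exists (fun e : sub_gset E' => collapse (ini T1 (val e)))
       (fun e : sub_gset E' => collapse (ter T1 (val e))).
- by move=> g e; rewrite -collapse_act -ini_equivariant.
- by move=> g e; rewrite -collapse_act -ter_equivariant.
Defined.

Lemma compressed_tree : is_tree compressed.
Proof.
have tT1 : is_tree T1 by exact: is_tree_flip.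
have [[v0 _] _ _] := T_tree.
have vE (u : sub_gset U) : collapse (val u) = u.
  by apply: val_inj; rewrite /= r_fix //; exact: set_mem (valP u).
have side h (P : sub_gset U -> Prop) : inK h ->
    P (collapse (ini T1 h)) <-> P (collapse (ter T1 h)).
  move=> Kh; suff -> : collapse (ini T1 h) = collapse (ter T1 h) by [].
  by apply: val_inj; exact: r_T1.
apply: cut_tree; first by exists (collapse v0).
  move=> P v w c Pv; rewrite -(vE w).
  have l : linked T1 setT (val v) (val w) by exact: tree_linked.
  apply: (l [set x | P (collapse x)]).
    move=> h _; have [Kh|nKh] := pselect (inK h); first exact: side.
    exact: (c (exist _ h (mem_set nKh)) I).
  by rewrite /= vE.
move=> e; have [P [c Pi Pt]] := tree_cut tT1 (ends_ini T1 (val e)).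
have Pr x : P x <-> P (r x).
  have cK : unsplit T inK P.
    apply/(unsplit_flip (GSubset against_act)) => h Kh; apply: c => he.
    by have := set_mem (valP e); rewrite -he.
  have lx : linked T inK x (r x) by exact: r_linked.
  split; [exact: (lx P cK)|exact: (linked_sym lx cK)].
exists [set u | P (val u)]; split=> /=; last by move/(proj2 (Pr _)).
  move=> h he; rewrite -!Pr; apply: c => hv; apply: he; exact: val_inj.
exact: (proj1 (Pr _) Pi).
Qed.

Lemma compressed_compressing :
  compressing_operation T (GTree compressed_tree).
Proof.
exists (GSubset against_act), T1; split; first exact: reorients_flip.
have KE : ~` (gsubset_set E') = inK by rewrite /= setCK.
rewrite /compresses KE; split.
- by move=> v; exists (r v); exact: sink_ofE.
- by apply/seteqP; split=> v /sinkE.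
by move=> e; split; exact: sink_ofE.
Qed.

Lemma compressed_iso :
  gset_iso (sub_gset (gsubsetC E')) (sub_gset (gsubsetC U)).
Proof.
have Kval (e : sub_gset (gsubsetC E')) : inK (val e).
  by apply: contrapT; exact: set_mem (valP e).
pose f (e : sub_gset (gsubsetC E')) : sub_gset (gsubsetC U) :=
  exist _ (ini T1 (val e)) (mem_set (ini_notin (Kval e))).
exists f; split.
  by move=> g e; apply: val_inj; exact: (ini_equivariant T1).
have [|i iP] := @choice (sub_gset (gsubsetC U)) (sub_gset (gsubsetC E'))
    (fun a b => f b = a).
  move=> v; have [e Ke ev] := ini_exists (set_mem (valP v)).
  have nne : (~` (~` inK)) e by [].
  by exists (exist _ e (mem_set nne)); apply: val_inj.
exists i => // e; apply: val_inj; apply: ini_inj; [exact: Kval|exact: Kval|].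
exact: (congr1 (fun a : sub_gset (gsubsetC U) => val a) (iP (f e))).
Qed.

End Compression.

Theorem theorem4p6 (G : groupType) (V E : gset G) (T : gtree V E)
    (U : gsubset V) (hU : gretract U)
    (hinc : conj_incomparable_stabilizers E \/
            conj_incomparable_stabilizers (sub_gset (gsubsetC U))) :
  exists (T1 : gtree V E) (E' : gsubset E)
      (T' : gtree (sub_gset U) (sub_gset E')),
    [/\ sliding_sequence T T1,
        compressing_operation T1 T'
      & gset_iso (sub_gset (gsubsetC E')) (sub_gset (gsubsetC U))].
Proof.
have incomparable w : ~ (U : set V) w -> conj_incomparable (stab w).
  move=> nw; case: hinc => [incE|incV]; last first.
    have := incV (exist _ w (mem_set nw)).
    set w' : sub_gset (gsubsetC U) := exist _ w _.
    suff -> : stab w' = stab w by [].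
    apply/seteqP; split=> g; last by move=> gw; apply: val_inj.
    by move/(congr1 (fun a : sub_gset (gsubsetC U) => val a)).
  (* The edge leading from [w] towards [u] has the stabilizer of [w]. *)
  have [u uU swu] := hU w nw.
  have l : linked T (setT `&` [set e | stab w `<=` stab e]) w u.
    apply: linked_fixed => //; first exact: gtree_is_tree.
    exact: tree_linked (gtree_is_tree T).
  have [e se] : exists e : E, stab e = stab w.
    apply: contrapT => no; apply: nw; have wu : [set w] u.
      apply: (l [set w]) => // e [_ /= we].
      have ex x y : ends T e x y -> x <> w.
        move=> exy xw; apply: no; exists e; apply/seteqP; split=> //.
        by rewrite -xw; exact: stab_end exy.
      have e1 := ex _ _ (ends_ini T e).
      have e2 := ex _ _ (endsC (ends_ini T e)).
      by split=> [/e1|/e2].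
    by rewrite -wu.
  by rewrite -se; exact: incE.
have [s gs sU] := fully_absorbed T hU incomparable.
pose K : gsubset E := GSubset (merged_act gs).
have tT := gtree_is_tree (now s).
exists (now s), (gsubsetC K).
exists (GTree (@compressed_tree _ _ _ (now s) tT U K (rep s) (rep_act gs) sU
  (rep_inU gs) (merged_rep gs) (rep_linked gs))).
split.
- exact: run_sequence (good_run gs).
- exact: compressed_compressing.
- exact: (@compressed_iso _ _ _ (now s) tT U K (rep s) (rep_act gs) sU
    (rep_inU gs) (merged_rep gs) (rep_linked gs)).
Qed.
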